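(* There exist universal constants $c,C,c_\epsilon>0$ and $d_0\in\mathbb{N}$ such that for every integer $d$ and all $R,\beta,\epsilon>0$ with $$d\ge d_0,\qquad \beta R^2\left(\frac{\log(ed)}{d}\right)^{2/3}\le\epsilon\le c_\epsilon\beta R^2,$$ one has $$c\,d\sqrt{\frac{\beta R^2}{\epsilon}}\le N_{\epsilon,\mathrm{det-ad}}^{\mathrm{val}}(d,R,\beta)\le C\,d\sqrt{\frac{\beta R^2}{\epsilon}}.$$
   Context: Here $\log$ is the natural logarithm, $\mathbb N$ is the set of positive integers, $\mathbb N_0=\mathbb N\cup\{0\}$, $\|\cdot\|_2$ is the Euclidean norm on $\mathbb{R}^d$, $B_2^d(r)=\{x\in\mathbb{R}^d:\|x\|_2\le r\}$, and $X:=B_2^d(R)$. ''Universal'' means independent of $d,R,\beta,\epsilon$. Objective class: $\mathcal F_\beta(d,R)$ is the set of all functions $f:\mathbb{R}^d\to\mathbb{R}$ such that (i) $f$ is convex and continuously differentiable; (ii) $\nabla f$ is globally $\beta$-Lipschitz in Euclidean norm; (iii) $f$ has a unique global minimizer $x_f^\star\in B_2^d(R/2)$. Write $f^\star=\min_x f(x)$. Algorithms: a deterministic adaptive algorithm with budget $T$ (a $T$-call algorithm) consists of Borel maps $Q_t:(X\times\mathbb{R})^{t-1}\to X$, $t=1,\dots,T$, and a Borel terminal map $Q_{\mathrm{out}}:(X\times\mathbb{R})^T\to X$; these may depend on the public parameters $(d,R,\beta,\epsilon)$. Run on a fixed objective $f$, it recursively produces the queries $x_t=Q_t((x_1,f(x_1)),\dots,(x_{t-1},f(x_{t-1})))$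 and the output $\widehat x=\widehat x_f=Q_{\mathrm{out}}((x_1,f(x_1)),\dots,(x_T,f(x_T)))$. Complexity: for $\epsilon>0$, $N_{\epsilon,\mathrm{det-ad}}^{\mathrm{val}}(d,R,\beta)$ is the infimum (with $\inf\varnothing=+\infty$) of all $T\in\mathbb{N}_0$ for which there exists a deterministic adaptive $T$-call algorithm such that $\sup_{f\in\mathcal F_\beta(d,R)}[f(\widehat x_f)-f^\star]\le\epsilon$. *)

(* Defs.v *)
From mathcomp Require Import all_boot all_order all_algebra.
From mathcomp Require Import all_classical all_reals all_analysis.

Set Implicit Arguments.
Unset Strict Implicit.
Unset Printing Implicit Defensive.

Import Order.TTheory GRing.Theory Num.Theory.
Import numFieldNormedType.Exports.

Local Open Scope classical_set_scope.
Local Open Scope ring_scope.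

(* The library norm on 'rV[R]_d is the sup norm; it induces the same topology
   and the same differentials as the Euclidean norm, but the balls and the
   Lipschitz constants below have to be Euclidean. *)
Definition norm2 (R : realType) (d : nat) (x : 'rV[R]_d) : R :=
  Num.sqrt (\sum_(i < d) x 0 i ^+ 2).

Definition ball2 (R : realType) (d : nat) (r : R) : set 'rV[R]_d :=
  [set x | norm2 x <= r].

Definition gradient (R : realType) (d : nat) (f : 'rV[R]_d -> R)
    (x : 'rV[R]_d) : 'rV[R]_d :=
  \row_(i < d) 'D_(delta_mx 0 i) f x.

Definition minimizers (R : realType) (d : nat) (f : 'rV[R]_d -> R) :
    set 'rV[R]_d :=
  [set x | forall y, f x <= f y].

(* The infimum is attained for every [f] in [objective]. *)
Definition min_value (R : realType) (d : nat) (f : 'rV[R]_d -> R) : R :=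
  inf (range f).

Record objective (R : realType) (d : nat) (r beta : R)
    (f : 'rV[R]_d -> R) : Prop := Objective {
  objective_convex : @convex_function R 'rV[R]_d setT f ;
  objective_differentiable : forall x, differentiable f x ;
  objective_C1 : continuous (gradient f) ;
  objective_lipschitz : forall x y,
    norm2 (gradient f x - gradient f y) <= beta * norm2 (x - y) ;
  objective_minimizer :
    exists2 x, ball2 (r / 2) x & unique (minimizers f) x }.

Definition borelRd (R : realType) (d : nat) :=
  g_sigma_algebraType (@open 'rV[R]_d).

(* [t.-tuple (observation R d)] carries the product of the Borel sigma-algebras,
   which is the Borel sigma-algebra of the product space since all factors are
   second countable. *)
Definition observation (R : realType) (d : nat) : Type :=
  (borelRd R d * measurableTypeR R)%type.

Definition transcripts (R : realType) (d : nat) (r : R) (t : nat) :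
    set (t.-tuple (observation R d)) :=
  [set h | forall i, ball2 r (tnth h i).1].
Arguments transcripts {R d} r t _.

(* A map defined on (X * R)^t, with X = ball2 r, is represented by a map on
   t-tuples of which only the restriction to [transcripts r t] matters. Being
   [measurable_fun] on that closed set means being Borel for the subspace. *)
Definition borel_map (R : realType) (d : nat) (r : R) (t : nat)
    (Q : t.-tuple (observation R d) -> borelRd R d) : Prop :=
  measurable_fun (transcripts r t) Q /\
  (forall h, transcripts r t h -> ball2 r (Q h)).

(* [query A t] computes the (t+1)-st query point from the first t observations;
   the values [query A t] with T <= t are never used. *)
Record algorithm (R : realType) (d : nat) (r : R) (T : nat) := Algorithm {
  query : forall t : nat, t.-tuple (observation R d) -> borelRd R d ;
  output : T.-tuple (observation R d) -> borelRd R d ;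
  query_borel : forall t : nat, (t < T)%N -> borel_map r (@query t) ;
  output_borel : borel_map r output }.

Fixpoint transcript (R : realType) (d : nat) (r : R) (T : nat)
    (A : algorithm d r T) (f : 'rV[R]_d -> R) (t : nat) :
    t.-tuple (observation R d) :=
  match t with
  | 0 => [tuple]
  | t'.+1 => let h := transcript A f t' in
             let x := query A h in
             [tuple of rcons h (x, f x)]
  end.

Definition run (R : realType) (d : nat) (r : R) (T : nat)
    (A : algorithm d r T) (f : 'rV[R]_d -> R) : 'rV[R]_d :=
  output A (transcript A f T).

Definition worst_case_gap (R : realType) (d : nat) (r beta : R) (T : nat)
    (A : algorithm d r T) : \bar R :=
  ereal_sup [set (f (run A f) - min_value f)%:E | f in objective r beta].

Definition det_ad_complexity (R : realType) (d : nat) (r beta eps : R) :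
    \bar R :=
  ereal_inf [set (T%:R)%:E | T in [set T : nat |
    exists A : algorithm d r T, (worst_case_gap beta A <= eps%:E)%E]].

(* Main.v *)
(** Lower bound.  A resisting oracle plays the convex chain
    [f x = g * (sum_(i < 2K) p (z_i - z_(i+1) - a) - a z_0) + s/2 |x|^2] with
    [z_i = <v_i, x>], [z_(2K) = 0], [p t = max(t, 0)^2 / 2] and orthonormal [v_i].
    The dead zone [a] hides [v_i] until [z_(i-1)] or [z_i] exceeds [a/2], so the
    oracle can postpone the choice of [v_i]: queries come in [K] blocks of about
    [d/4], and after the [i]-th block [v_i] is taken orthogonal to the queries of
    that block and nearly orthogonal to all queries.  Such a direction exists
    because the sum of greedily signed orthonormal vectors, once normalized, has
    inner product [O(r sqrt(log d / d))] with each of polynomially many vectors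
    of norm at most [r]; this has to be below [a ~ r K^(-3/2)], which is the
    hypothesis [eps >= beta r^2 (log(ed)/d)^(2/3)].  If fewer than about [d K / 4]
    values are requested, the second half of the chain is invisible and the gap
    is of order [beta r^2 / K^2].

    Upper bound.  Exact values give gradients to arbitrary accuracy by finite
    differences with [d + 1] queries each, and [O(sqrt(beta r^2 / eps))] steps of
    a projected accelerated gradient method suffice. *)

Require Import Defs.
From HB Require Import structures.
From mathcomp Require Import all_boot all_order all_algebra.
From mathcomp Require Import all_classical all_reals all_analysis.
From mathcomp Require Import measurable_realfun zify ring lra.

Set Implicit Arguments.
Unset Strict Implicit.
Unset Printing Implicit Defensive.

Import Order.TTheory GRing.Theory Num.Theory.
Import numFieldNormedType.Exports.

Local Open Scope classical_set_scope.
Local Open Scope ring_scope.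

(** * Euclidean geometry and smooth convex functions *)

Section Euclidean.
Context {R : realType} {d : nat}.
Implicit Types x y z v w : 'rV[R]_d.

Definition dot x y : R := \sum_(i < d) x 0 i * y 0 i.

Lemma dotC x y : dot x y = dot y x.
Proof. by apply: eq_bigr => i _; rewrite mulrC. Qed.

Lemma dotDl x y z : dot (x + y) z = dot x z + dot y z.
Proof. by rewrite -big_split; apply: eq_bigr => i _; rewrite mxE mulrDl. Qed.

Lemma dotZl c x y : dot (c *: x) y = c * dot x y.
Proof. by rewrite mulr_sumr; apply: eq_bigr => i _; rewrite mxE mulrA. Qed.

Lemma dotNl x y : dot (- x) y = - dot x y.
Proof. by rewrite -scaleN1r dotZl mulN1r. Qed.

Lemma dot0l y : dot 0 y = 0.
Proof. by rewrite -(scale0r 0) dotZl mul0r. Qed.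

Lemma dotBl x y z : dot (x - y) z = dot x z - dot y z.
Proof. by rewrite dotDl dotNl. Qed.

Lemma dotDr x y z : dot x (y + z) = dot x y + dot x z.
Proof. by rewrite !(dotC x) dotDl. Qed.

Lemma dotZr c x y : dot x (c *: y) = c * dot x y.
Proof. by rewrite !(dotC x) dotZl. Qed.

Lemma dotNr x y : dot x (- y) = - dot x y.
Proof. by rewrite !(dotC x) dotNl. Qed.

Lemma dotBr x y z : dot x (y - z) = dot x y - dot x z.
Proof. by rewrite dotDr dotNr. Qed.

Lemma dot0r x : dot x 0 = 0.
Proof. by rewrite dotC dot0l. Qed.

Lemma dot_suml (I : Type) (s : seq I) (P : pred I) (F : I -> 'rV[R]_d) y :
  dot (\sum_(i <- s | P i) F i) y = \sum_(i <- s | P i) dot (F i) y.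
Proof.
elim/big_rec2: _ => [|i u v _ <-]; first by rewrite dot0l.
by rewrite dotDl.
Qed.

Lemma dot_sumr (I : Type) (s : seq I) (P : pred I) (F : I -> 'rV[R]_d) x :
  dot x (\sum_(i <- s | P i) F i) = \sum_(i <- s | P i) dot x (F i).
Proof. by rewrite dotC dot_suml; apply: eq_bigr => i _; rewrite dotC. Qed.

Definition dotE := (dotDl, dotDr, dotBl, dotBr, dotNl, dotNr, dotZl, dotZr,
  dot0l, dot0r).

Lemma dot_delta x (i : 'I_d) : dot x (delta_mx 0 i) = x 0 i.
Proof.
rewrite /dot (bigD1 i)//= mxE !eqxx mulr1 big1 ?addr0// => j ji.
by rewrite mxE (negPf ji) andbF mulr0.
Qed.

Lemma dot_ge0 x : 0 <= dot x x.
Proof. by apply: sumr_ge0 => i _; rewrite -expr2 sqr_ge0. Qed.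

Lemma dot_eq0 x : dot x x = 0 -> x = 0.
Proof.
move=> /eqP; rewrite psumr_eq0; last by move=> i _; rewrite -expr2 sqr_ge0.
move=> /allP h; apply/rowP => i; rewrite mxE.
by have := h i (mem_index_enum i); rewrite /= mulf_eq0 orbb => /eqP.
Qed.

Lemma sqr_norm2 x : norm2 x ^+ 2 = dot x x.
Proof.
rewrite /norm2 (_ : \sum_(i < d) _ = dot x x).
  by rewrite sqr_sqrtr ?dot_ge0.
by apply: eq_bigr => i _; rewrite expr2.
Qed.

Lemma norm2_ge0 x : 0 <= norm2 x.
Proof. exact: sqrtr_ge0. Qed.

Lemma norm2_le_dot x r : 0 <= r -> (norm2 x <= r) = (dot x x <= r ^+ 2).
Proof. by move=> r0; rewrite -sqr_norm2 ler_sqr// nnegrE norm2_ge0. Qed.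

Lemma Cauchy_Schwarz_sqr x y : dot x y ^+ 2 <= dot x x * dot y y.
Proof.
have [y0|y0] := eqVneq (dot y y) 0.
  by rewrite (dot_eq0 y0) !dot0r expr0n mulr0.
have ygt0 : 0 < dot y y by rewrite lt_def y0 dot_ge0.
have := dot_ge0 (dot y y *: x - dot x y *: y).
rewrite !dotE (dotC y x) => h.
rewrite -subr_ge0 -(pmulr_rge0 _ ygt0).
by rewrite (le_trans h)// le_eqVlt; apply/orP; left; apply/eqP; ring.
Qed.

Lemma Cauchy_Schwarz x y : dot x y <= norm2 x * norm2 y.
Proof.
have [h|/ltW h] := leP (dot x y) 0.
  by rewrite (le_trans h)// mulr_ge0// norm2_ge0.
rewrite -ler_sqr ?nnegrE// ?mulr_ge0// ?norm2_ge0//.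
by rewrite exprMn !sqr_norm2 Cauchy_Schwarz_sqr.
Qed.

Lemma norm2N x : norm2 (- x) = norm2 x.
Proof.
apply/eqP; rewrite -(@eqrXn2 _ 2) ?norm2_ge0// !sqr_norm2 !dotE opprK.
by [].
Qed.

Lemma Cauchy_Schwarz_norm x y : `|dot x y| <= norm2 x * norm2 y.
Proof.
by rewrite ler_norml lerNl -dotNl Cauchy_Schwarz -(norm2N x) Cauchy_Schwarz.
Qed.

Lemma ler_norm2D x y : norm2 (x + y) <= norm2 x + norm2 y.
Proof.
rewrite -ler_sqr ?nnegrE ?addr_ge0 ?norm2_ge0//.
rewrite sqrrD !sqr_norm2 !dotE (dotC y x).
by have := Cauchy_Schwarz x y; lra.
Qed.

Lemma ler_norm2B x y : norm2 (x - y) <= norm2 x + norm2 y.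
Proof. by rewrite (le_trans (ler_norm2D _ _))// norm2N. Qed.

Lemma normr_coord_le_mxnorm x (i : 'I_d) : `|x 0 i| <= `|x|.
Proof.
by rewrite [leRHS]/Num.norm /= mx_normrE; apply/bigmax_geP; right => /=; exists (0, i).
Qed.

Lemma dot_le_mxnorm x : dot x x <= d%:R * `|x| ^+ 2.
Proof.
rewrite -[in d%:R](card_ord d) mulr_natl -sumr_const; apply: ler_sum => i _.
by rewrite -expr2 -real_normK ?num_real// lerXn2r// ?nnegrE// normr_coord_le_mxnorm.
Qed.

End Euclidean.

Lemma dot_continuous (R : realType) (d : nat) (g : 'rV[R]_d) :
  continuous (dot g).
Proof.
apply: (@continuous_big R _ +%R 0 xpredT) => [|i _ x]; first exact: add_continuous.
apply: (@continuousM _ _ (fun=> g 0 i) (fun y : 'rV[R]_d => y 0 i)).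
  exact: cst_continuous.
exact: coord_continuous.
Qed.

Lemma dot_linear (R : realType) (d : nat) (g : 'rV[R]_d) : linear (dot g).
Proof. by move=> c x y; rewrite dotDr dotZr. Qed.

Lemma gradient_of_quadratic_remainder (R : realType) (d : nat)
    (f : 'rV[R]_d -> R) (x g : 'rV[R]_d) (C : R) :
  (forall h, `|f (x + h) - f x - dot g h| <= C * dot h h) ->
  differentiable f x /\ gradient f x = g.
Proof.
move=> fC.
pose dg : {linear 'rV[R]_d -> R} :=
  HB.pack (dot g) (GRing.isLinear.Build _ _ _ _ _ (dot_linear g)).
have dgc : continuous dg by exact: dot_continuous.
have fo : (f : 'rV[R]_d -> R^o) \o shift x =
    cst (f x) + (dg : 'rV[R]_d -> R^o) +o_ (0 : 'rV[R]_d) id.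
  apply/eqaddoP => _/posnumP[e].
  have C1 : 0 < `|C| * d%:R + 1 by rewrite ltr_wpDl// mulr_ge0.
  near=> h.
  have -> : (f \o shift x - (cst (f x) + dg)) h = f (x + h) - f x - dot g h.
    by rewrite -[LHS]/(f (h + x) - (f x + dot g h)) (addrC h) opprD addrA.
  rewrite (le_trans (fC h))//.
  have : C * dot h h <= `|C| * (d%:R * `|h| ^+ 2).
    apply: (@le_trans _ _ (`|C| * dot h h)).
      by rewrite ler_wpM2r ?dot_ge0 ?ler_norm.
    by rewrite ler_wpM2l ?dot_le_mxnorm.
  move/le_trans; apply.
  have he : `|h| <= e%:num / (`|C| * d%:R + 1).
    near: h.
    exact: (@nbhs0_le R ('rV[R]_d : normedModType R) _ (divr_gt0 (gt0 e) C1)).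
  rewrite mulrA expr2 mulrA ler_wpM2r//.
  rewrite (le_trans (ler_wpM2l _ he)) ?mulr_ge0//.
  rewrite mulrA ler_pdivrMr// mulrC ler_wpM2l//.
  by rewrite lerDl.
have df : 'd f x = dg :> (_ -> _) by apply: diff_unique.
have fd : differentiable f x.
  by apply/diff_locallyP; rewrite df.
split=> //; apply/rowP => i; rewrite mxE deriveE// df/=.
exact: dot_delta.
Unshelve. all: by end_near. Qed.

Section SmoothFunctions.
Context {R : realType} {d : nat}.
Variables (f : 'rV[R]_d -> R) (beta : R).
Hypothesis beta_ge0 : 0 <= beta.
Hypothesis fd : forall x, differentiable f x.
Hypothesis fL : forall x y,
  norm2 (gradient f x - gradient f y) <= beta * norm2 (x - y).

Lemma derive_gradient x v : 'D_v f x = dot (gradient f x) v.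
Proof.
rewrite deriveE// [in LHS](matrix_sum_delta v) big_ord1 linear_sum/=.
by apply: eq_bigr => i _; rewrite linearZ/= mxE deriveE// mulrC.
Qed.

Lemma gradient_mean_value x v :
  exists2 t, 0 <= t <= 1 & f (x + v) - f x = dot (gradient f (x + t *: v)) v.
Proof.
pose g t := f (x + t *: v).
have dg t : is_derive t (1 : R) g (dot (gradient f (x + t *: v)) v).
  have dv : derivable f (x + t *: v) v by exact: diff_derivable.
  have eqg : (fun h : R => h^-1 *: ((g \o shift t) (h *: (1 : R)) - g t)) =
      (fun h : R => h^-1 *: ((f \o shift (x + t *: v)) (h *: v) - f (x + t *: v))).
    apply/funext => h; rewrite /g/=; congr (_ *: (f _ - _)).
    by rewrite -[h *: 1]/(h * 1) mulr1 scalerDl addrCA.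
  by apply: DeriveDef; [rewrite /derivable eqg | rewrite -derive_gradient /derive eqg].
have gc : {within `[0, 1], continuous g}.
  apply: continuous_subspaceT => t.
  apply: (@differentiable_continuous _ R R^o t g); apply/derivable1_diffP.
  by have [] := dg t.
have [t t01] := MVT_segment (@ler01 R) (fun t _ => dg t) gc.
rewrite /g scale1r scale0r addr0 subr0 mulr1 => gE.
by exists t => //; move: t01; rewrite in_itv.
Qed.

Lemma quadratic_remainder x v :
  `|f (x + v) - f x - dot (gradient f x) v| <= beta * dot v v.
Proof.
have [t /andP[t0 t1] ->] := gradient_mean_value x v.
rewrite -dotBl (le_trans (Cauchy_Schwarz_norm _ _))//.
rewrite -sqr_norm2 expr2 mulrA ler_wpM2r ?norm2_ge0//.
rewrite (le_trans (fL _ _))// addrC addKr ler_wpM2l//.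
rewrite norm2_le_dot ?norm2_ge0// dotZl dotZr sqr_norm2 mulrA.
by rewrite ler_piMl ?dot_ge0// mulr_ile1.
Qed.

Hypothesis fconv : @convex_function R 'rV[R]_d setT f.

Lemma convex_chord x y t : 0 <= t <= 1 ->
  f (x + t *: (y - x)) <= f x + t * (f y - f x).
Proof.
move=> /andP[t0 t1].
have tP : Itv.spec (@Itv.num_sem R) (Itv.Real `[0, 1]%Z) t.
  by rewrite /= /Itv.num_sem/= num_real/= in_itv/= t0 t1.
have h : f (t *: y + (1 - t) *: x) <= t * f y + (1 - t) * f x.
  by apply: (@fconv (Itv.mk tP) y x); rewrite inE.
have -> : x + t *: (y - x) = t *: y + (1 - t) *: x.
  by rewrite scalerBr scalerBl scale1r addrCA addrC -addrA [- _ + _]addrC.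
by rewrite (le_trans h)//; lra.
Qed.

Lemma convex_above_tangent x y :
  f x + dot (gradient f x) (y - x) <= f y.
Proof.
rewrite leNgt; apply/negP => hlt.
pose e := f x + dot (gradient f x) (y - x) - f y.
have e0 : 0 < e by rewrite subr_gt0.
set v := y - x in hlt e e0.
have D0 : 0 < beta * dot v v + e by rewrite ltr_wpDl// mulr_ge0// dot_ge0.
pose t := e / (2 * (beta * dot v v + e)).
have t0 : 0 < t by rewrite divr_gt0// mulr_gt0.
have t1 : t <= 1.
  rewrite ler_pdivrMr ?mulr_gt0// mul1r.
  have : 0 <= beta * dot v v by rewrite mulr_ge0// dot_ge0.
  by lra.

have tb : t * (beta * dot v v) < e.
  rewrite /t mulrAC ltr_pdivrMr ?mulr_gt0//.
  have : 0 <= beta * dot v v by rewrite mulr_ge0// dot_ge0.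
  by move: e0; nra.
have t01 : 0 <= t <= 1 by rewrite ltW.
have h2 := convex_chord x y t01; rewrite -/v in h2.
have /ler_normlP[h1 _] := quadratic_remainder x (t *: v).
rewrite !dotZr dotZl in h1.
have : t * (dot (gradient f x) v - f y + f x) <= t * (t * (beta * dot v v)).
  by lra.
rewrite ler_pM2l//.
by move: tb; rewrite /e; lra.
Qed.

End SmoothFunctions.

Lemma min_value_attained (R : realType) (d : nat) (f : 'rV[R]_d -> R) x :
  minimizers f x -> min_value f = f x.
Proof.
move=> fx; apply/eqP; rewrite eq_le; apply/andP; split.
  by apply: ge_inf; [exists (f x) => _ [y _ <-] | exists x].
by apply: lb_le_inf; [exists (f x), x | move=> _ [y _ <-]].
Qed.

(** * Directions nearly orthogonal to finitely many vectors *)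

Lemma exists_unit_orthogonal (R : realType) (d : nat) (S : seq 'rV[R]_d) :
  (size S < d)%N ->
  exists2 u : 'rV[R]_d, dot u u = 1 & forall s, s \in S -> dot u s = 0.
Proof.
move=> Sd; pose M : 'M[R]_(size S, d) := \matrix_(i < size S) S`_i.
have : kermx M^T != 0.
  rewrite -mxrank_eq0 mxrank_ker -lt0n subn_gt0.
  by rewrite (leq_ltn_trans (rank_leq_col _)).
case/rowV0Pn => w /sub_kermxP wM w0.
have ww : 0 < dot w w.
  by rewrite lt_def dot_ge0 andbT; apply: contraNneq w0 => /dot_eq0 ->.
exists ((Num.sqrt (dot w w))^-1 *: w) => [|s sS].
  rewrite dotZl dotZr mulrA -invfM -expr2 sqr_sqrtr ?(ltW ww)// mulVf//.
  by rewrite gt_eqF.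
rewrite dotZl [X in _ * X](_ : _ = 0) ?mulr0//.
have iS : (index s S < size S)%N by rewrite index_mem.
have := congr1 (fun N : 'rV_(size S) => N 0 (Ordinal iS)) wM.
rewrite !mxE => <-; apply: eq_bigr => j _.
by rewrite !mxE /= nth_index.
Qed.

Lemma cosh_le_expR (R : realType) (x : R) :
  expR x + expR (- x) <= 2 * expR (2 * x ^+ 2).
Proof.
wlog x0 : x / 0 <= x => [H|].
  have [|/ltW x0] := leP 0 x; first exact: H.
  by have := H (- x); rewrite oppr_ge0 opprK sqrrN addrC; apply.
have [x2|x2] := leP x (1 / 2); last first.
  have : expR x <= expR (2 * x ^+ 2) by rewrite ler_expR; nra.
  have : expR (- x) <= expR (2 * x ^+ 2) by rewrite ler_expR; nra.
  lra.
have inv_bound (y : R) : y < 1 -> expR y <= (1 - y)^-1.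
  move=> y1; rewrite -[y in expR y]opprK expRN lef_pV2 ?posrE ?expR_gt0 ?subr_gt0//.
  by rewrite (le_trans _ (expR_ge1Dx _)).
have h1 : expR x <= (1 - x)^-1 by apply: inv_bound; lra.
have h2 : expR (- x) <= (1 + x)^-1.
  by have := inv_bound (- x); rewrite opprK; apply; lra.
have h3 : 1 + 2 * x ^+ 2 <= expR (2 * x ^+ 2) by exact: expR_ge1Dx.
have h4 : (1 - x)^-1 + (1 + x)^-1 <= 2 * (1 + 2 * x ^+ 2).
  have -> : (1 - x)^-1 + (1 + x)^-1 = 2 / ((1 - x) * (1 + x)).
    have n1 : 1 - x != 0 by rewrite gt_eqF//; lra.
    have n2 : 1 + x != 0 by rewrite gt_eqF//; lra.
    by field; rewrite n1 n2.
  rewrite ler_pdivrMr; last by nra.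
  have : 0 <= x ^+ 2 * (1 - 2 * x ^+ 2) by rewrite mulr_ge0 ?sqr_ge0//; nra.
  by lra.
lra.
Qed.

(* The signs are chosen greedily, one orthogonal direction at a time, so that
   the exponential potential of the sum does not increase; [e p] is the part of
   [p] orthogonal to the directions already used. *)
Lemma greedy_signs (R : realType) (d : nat) (S P : seq 'rV[R]_d) (l : R) n :
  (size S + n <= d)%N ->
  exists (U : seq 'rV[R]_d) (w : 'rV[R]_d) (e : 'rV[R]_d -> 'rV[R]_d),
    [/\ size U = n,
        forall u, (forall u', u' \in U -> dot u u' = 0) ->
          dot u w = 0 /\ forall p, dot u (e p) = dot u p,
        dot w w = n%:R,
        forall s, s \in S -> dot w s = 0 &
        \sum_(p <- P) (expR (l * dot w p) + expR (- (l * dot w p))) *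
           expR (- (2 * l ^+ 2 * (dot p p - dot (e p) (e p))))
        <= 2 * (size P)%:R].
Proof.
elim: n => [|n IH] Sn.
  exists [::], 0, id; split=> //; rewrite ?dot0l//.
  - by move=> u _; rewrite dot0r.
  - by move=> s _; rewrite dot0l.
  - under eq_bigr do rewrite dot0l mulr0 oppr0 subrr mulr0 oppr0 expR0 mulr1.
    by rewrite big_const_seq count_predT iter_addr addr0 mulr_natr.
have {IH}[|U [w [e [sU Uw ww wS Phi]]]] := IH; first by lia.
have [|u uu uSU] := @exists_unit_orthogonal R d (S ++ U).
  by rewrite size_cat sU; lia.
have uS s : s \in S -> dot u s = 0.
  by move=> sS; apply: uSU; rewrite mem_cat sS.
have uU u' : u' \in U -> dot u u' = 0.
  by move=> sS; apply: uSU; rewrite mem_cat sS orbT.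
have [uw ue] := Uw _ uU.
pose e' p := e p - dot u p *: u.
have e'E p : dot (e' p) (e' p) = dot (e p) (e p) - dot u p ^+ 2.
  by rewrite /e' !dotE uu (dotC _ u) ue; ring.
pose G (w : 'rV[R]_d) p := (expR (l * dot w p) + expR (- (l * dot w p))) *
   expR (- (2 * l ^+ 2 * (dot p p - dot (e' p) (e' p)))).
have sumG : \sum_(p <- P) G (w + u) p + \sum_(p <- P) G (w - u) p <=
    2 * (2 * (size P)%:R).
  rewrite -big_split/=; apply: le_trans (ler_wpM2l _ Phi) => //.
  rewrite mulr_sumr; apply: ler_sum => p _; rewrite /G e'E.
  set A := dot p p - dot (e p) (e p).
  have -> : - (2 * l ^+ 2 * (dot p p - (dot (e p) (e p) - dot u p ^+ 2))) =
     - (2 * l ^+ 2 * A) + - (2 * (l * dot u p) ^+ 2) by rewrite /A; ring.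
  rewrite expRD !dotE !(mulrDr l) mulrN !opprD !opprK !expRD.
  have := cosh_le_expR (l * dot u p).
  set a := expR (l * dot w p); set b := expR (- (l * dot w p)).
  set x := expR (l * dot u p); set y := expR (- (l * dot u p)).
  rewrite [expR (- (2 * (l * _) ^+ 2))]expRN.
  have := expR_gt0 (2 * (l * dot u p) ^+ 2).
  set E := expR (2 * (l * _) ^+ 2) => E0 xyE.
  set D := expR (- _).
  have ab : 0 <= (a + b) * D.
    by rewrite mulr_ge0 ?addr_ge0// expR_ge0.
  have -> : (a * x + b * y) * (D / E) + (a * y + b * x) * (D / E) =
      ((a + b) * D) * ((x + y) / E) by ring.
  rewrite mulrC ler_wpM2r// ler_pdivrMr//.
have new s (s1 : s ^+ 2 = 1) (Gs : \sum_(p <- P) G (w + s *: u) p <= 2 * (size P)%:R) :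
  exists (U : seq 'rV[R]_d) (w : 'rV[R]_d) (e : 'rV[R]_d -> 'rV[R]_d),
    [/\ size U = n.+1,
        forall u, (forall u', u' \in U -> dot u u' = 0) ->
          dot u w = 0 /\ forall p, dot u (e p) = dot u p,
        dot w w = n.+1%:R,
        forall s, s \in S -> dot w s = 0 &
        \sum_(p <- P) (expR (l * dot w p) + expR (- (l * dot w p))) *
           expR (- (2 * l ^+ 2 * (dot p p - dot (e p) (e p))))
        <= 2 * (size P)%:R].
  exists (u :: U), (w + s *: u), e'; split => //=.
  - by rewrite sU.
  - move=> z zU; have zu : dot z u = 0 by apply: zU; rewrite inE eqxx.
    have [zw ze] : dot z w = 0 /\ forall p, dot z (e p) = dot z p.
      by apply: Uw => u' u'U; apply: zU; rewrite inE u'U orbT.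
    by split=> [|p]; rewrite /e' !dotE ?zw ?ze zu ?mulr0 ?addr0 ?subr0.
  - rewrite !dotE uu (dotC w) uw mulr0 add0r addr0 mulr1 -expr2 s1 ww.
    by rewrite -natr1.
  - by move=> z zS; rewrite !dotE wS// uS// mulr0 addr0.
have [Gp|Gm] := leP (\sum_(p <- P) G (w + u) p) (2 * (size P)%:R).
  by apply: (new 1); rewrite ?expr1n// scale1r.
apply: (new (-1)); rewrite ?sqrrN ?expr1n// scaleN1r; lra.
Qed.

Lemma exists_flat_direction (R : realType) (d : nat) (S P : seq 'rV[R]_d)
    (n : nat) (r lam : R) :
  0 < r -> 0 < lam -> (0 < n)%N -> (size S + n <= d)%N ->
  (2 * size P)%:R <= expR lam ->
  (forall p, p \in P -> dot p p <= r ^+ 2) ->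
  exists v, [/\ dot v v = 1, forall s, s \in S -> dot v s = 0 &
    forall p, p \in P -> dot v p ^+ 2 <= 8 * r ^+ 2 * lam / n%:R].
Proof.
move=> r0 lam0 n0 Sn Plam Pr.
pose l := Num.sqrt (lam / 2) / r.
have l0 : 0 < l by rewrite divr_gt0// sqrtr_gt0 divr_gt0.
have l2 : l ^+ 2 = lam / (2 * r ^+ 2).
  rewrite /l exprMn sqr_sqrtr ?divr_ge0 ?(ltW lam0)// exprVn; field.
  by rewrite gt_eqF.
have [U [w [e [_ _ ww wS Phi]]]] := greedy_signs P l Sn.
have n0R : 0 < n%:R :> R by rewrite ltr0n.
exists ((Num.sqrt n%:R)^-1 *: w); split.
- by rewrite dotZl dotZr ww mulrA -invfM -expr2 sqr_sqrtr ?ltW// mulVf// gt_eqF.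
- by move=> s sS; rewrite dotZl wS// mulr0.
move=> p pP.
have wp : l * `|dot w p| <= 2 * lam.
  suff : expR (l * `|dot w p| - lam) <= expR lam by rewrite ler_expR; lra.
  apply: le_trans Plam.
  rewrite natrM; apply: le_trans Phi.
  rewrite (big_rem p)//= -[leLHS]addr0; apply: lerD; last first.
    by apply: sumr_ge0 => q _; rewrite mulr_ge0 ?addr_ge0// expR_ge0.
  rewrite expRD ler_pM ?expR_ge0//.
    have [_|_] := ger0P (dot w p); first by rewrite lerDl expR_ge0.
    by rewrite mulrN lerDr expR_ge0.
  rewrite ler_expR lerN2 l2.
  have h : dot p p - dot (e p) (e p) <= r ^+ 2.
    by have := Pr _ pP; have := dot_ge0 (e p); lra.
  rewrite (le_trans (ler_wpM2l _ h))//.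
    by rewrite mulr_ge0// divr_ge0 ?(ltW lam0)// mulr_ge0// sqr_ge0.
  by rewrite le_eqVlt; apply/orP; left; apply/eqP; field; rewrite gt_eqF.
rewrite dotZl exprMn exprVn sqr_sqrtr ?(ltW n0R)//.
rewrite [leLHS]mulrC ler_wpM2r ?invr_ge0 ?(ltW n0R)//.
rewrite -real_normK ?num_real//.
have : (l * `|dot w p|) ^+ 2 <= (2 * lam) ^+ 2.
  by rewrite lerXn2r// nnegrE mulr_ge0 ?(ltW l0) ?(ltW lam0).
have -> : 8 * r ^+ 2 * lam = (2 * lam) ^+ 2 / l ^+ 2.
  by rewrite l2; field; rewrite !gt_eqF.
rewrite ler_pdivlMr ?exprn_gt0// exprMn.
by rewrite mulrC.
Qed.

(** * The chain function *)

Section Hinge.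
Context {R : realType}.
Implicit Types s t a : R.

Definition hinge t : R := Num.max t 0.

Lemma hinge_remainder s t :
  0 <= hinge (s + t) ^+ 2 / 2 - hinge s ^+ 2 / 2 - hinge s * t <= t ^+ 2 / 2.
Proof.
rewrite /hinge; apply/andP.
by case: (lerP s 0) => hs; case: (lerP (s + t) 0) => hst; split; nra.
Qed.

Lemma hinge_lipschitz s t : (hinge s - hinge t) ^+ 2 <= (s - t) ^+ 2.
Proof.
rewrite /hinge.
case: (lerP s 0) => hs; case: (lerP t 0) => ht.
- by rewrite subrr expr0n sqr_ge0.
- by have := sqr_ge0 s; have := mulr_le0_ge0 hs (ltW ht); lra.
- by have := sqr_ge0 t; have := mulr_ge0_le0 (ltW hs) ht; lra.
- exact: lexx.
Qed.

Lemma hinge_eq0 t : t <= 0 -> hinge t = 0.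
Proof. by move=> t0; rewrite /hinge max_r. Qed.

Lemma hinge_young s a : 0 <= a -> - (3 / 2) * a ^+ 2 <= hinge (s - a) ^+ 2 / 2 - a * s.
Proof.
move=> a0; rewrite /hinge; case: (lerP (s - a) 0) => h.
  by have := mulr_ge0_le0 a0 h; have := sqr_ge0 a; lra.
by have := sqr_ge0 (s - 2 * a); lra.
Qed.

End Hinge.

Section Bessel.
Context {R : realType} {d : nat}.
Variables (k : nat) (v : nat -> 'rV[R]_d).
Hypothesis vO : forall i j, (i < k)%N -> (j < k)%N ->
  dot (v i) (v j) = (i == j)%:R.

Lemma dot_orthonormal_sum (c : nat -> R) j : (j < k)%N ->
  dot (v j) (\sum_(i < k) c i *: v i) = c j.
Proof.
move=> jk; rewrite dot_sumr (bigD1 (Ordinal jk))//= dotZr vO// eqxx mulr1.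
rewrite big1 ?addr0// => i ij; rewrite dotZr vO// (_ : (j == i) = false) ?mulr0//.
by apply: contraNF ij => /eqP ij; apply/eqP/val_inj.
Qed.

Lemma dot_orthonormal_sum2 (c : nat -> R) :
  dot (\sum_(i < k) c i *: v i) (\sum_(i < k) c i *: v i) = \sum_(i < k) c i ^+ 2.
Proof.
rewrite {1}dot_suml; apply: eq_bigr => i _.
by rewrite dotZl dot_orthonormal_sum// expr2.
Qed.

Lemma Bessel x : \sum_(i < k) dot (v i) x ^+ 2 <= dot x x.
Proof.
pose y := \sum_(i < k) dot (v i) x *: v i.
have xy : dot x y = \sum_(i < k) dot (v i) x ^+ 2.
  by rewrite dot_sumr; apply: eq_bigr => i _; rewrite dotZr (dotC x) expr2.
have yy : dot y y = \sum_(i < k) dot (v i) x ^+ 2.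
  exact: dot_orthonormal_sum2 (fun i => dot (v i) x).
by have := dot_ge0 (x - y); rewrite !dotE (dotC y x) xy yy; lra.
Qed.

Hypothesis vk : v k = 0.

Lemma Bessel_diff x : \sum_(i < k) dot (v i - v i.+1) x ^+ 2 <= 4 * dot x x.
Proof.
have shift_le : \sum_(i < k) dot (v i.+1) x ^+ 2 <= \sum_(i < k) dot (v i) x ^+ 2.
  have : \sum_(i < k.+1) dot (v i) x ^+ 2 = \sum_(i < k) dot (v i) x ^+ 2.
    by rewrite big_ord_recr/= vk dot0l expr0n addr0.
  by rewrite big_ord_recl => <-; rewrite lerDr sqr_ge0.
have : \sum_(i < k) dot (v i - v i.+1) x ^+ 2 <=
    \sum_(i < k) (2 * dot (v i) x ^+ 2 + 2 * dot (v i.+1) x ^+ 2).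
  apply: ler_sum => i _; rewrite dotBl.
  by have := sqr_ge0 (dot (v i) x + dot (v i.+1) x); nra.
rewrite big_split/= -!mulr_sumr.
by have := Bessel x; lra.
Qed.

Lemma Bessel_diff_dual (c : nat -> R) :
  dot (\sum_(i < k) c i *: (v i - v i.+1)) (\sum_(i < k) c i *: (v i - v i.+1))
  <= 4 * \sum_(i < k) c i ^+ 2.
Proof.
set w := (X in dot X _).
have : dot w w <= \sum_(i < k) (2 * c i ^+ 2 + dot (v i - v i.+1) w ^+ 2 / 8).
  rewrite {1}/w dot_suml; apply: ler_sum => i _; rewrite dotZl.
  by have := sqr_ge0 (4 * c i - dot (v i - v i.+1) w); nra.
rewrite big_split/= -mulr_sumr -mulr_suml.
by have := Bessel_diff w; lra.
Qed.

End Bessel.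

Lemma mxnorm_le_norm2 (R : realType) (d : nat) (x : 'rV[R]_d) : `|x| <= norm2 x.
Proof.
rewrite [leLHS]/Num.norm/= mx_normrE; apply/bigmax_leP; split.
  exact: norm2_ge0.
move=> [i j] _ /=; rewrite (ord1 i) -dot_delta.
rewrite (le_trans (Cauchy_Schwarz_norm _ _))// ler_piMr ?norm2_ge0//.
by rewrite norm2_le_dot// dot_delta mxE !eqxx expr1n.
Qed.

Lemma norm2_le_mxnorm (R : realType) (d : nat) (x : 'rV[R]_d) :
  norm2 x <= Num.sqrt d%:R * `|x|.
Proof.
rewrite norm2_le_dot ?mulr_ge0 ?sqrtr_ge0//.
by rewrite exprMn sqr_sqrtr// dot_le_mxnorm.
Qed.

Lemma lipschitz_norm2_continuous (R : realType) (d : nat)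
    (g : 'rV[R]_d -> 'rV[R]_d) (L : R) : 0 <= L ->
  (forall x y, norm2 (g x - g y) <= L * norm2 (x - y)) -> continuous g.
Proof.
move=> L0 gL x.
apply/(@cvgrPdist_le R ('rV[R]_d : normedModType R) _ (nbhs x) _ g (g x)).
move=> e e0.
have D0 : 0 < L * Num.sqrt d%:R + 1 by rewrite ltr_wpDl// mulr_ge0// sqrtr_ge0.
near=> y.
have xy : `|x - y| <= e / (L * Num.sqrt d%:R + 1).
  near: y.
  exact: (@cvgr_dist_le R ('rV[R]_d : normedModType R) _ (nbhs x) _ id x cvg_id
    _ (divr_gt0 e0 D0)).
rewrite (le_trans (mxnorm_le_norm2 _))// (le_trans (gL _ _))//.
rewrite (le_trans (ler_wpM2l L0 (norm2_le_mxnorm _)))// mulrA.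
rewrite (le_trans (ler_wpM2l _ xy)) ?mulr_ge0 ?sqrtr_ge0//.
by rewrite mulrCA ler_piMr ?(ltW e0)// ler_pdivrMr// mul1r lerDl.
Unshelve. all: by end_near. Qed.

Section Chain.
Context {R : realType} {d : nat}.
Variables (g s a : R) (k : nat).
Implicit Types (z : nat -> R) (v : nat -> 'rV[R]_d) (x : 'rV[R]_d).

Definition chain z : R :=
  \sum_(i < k) hinge (z i - z i.+1 - a) ^+ 2 / 2 - a * z 0.

Lemma chain_ge z j : 0 <= a -> (j <= k)%N ->
  - (3 / 2) * j%:R * a ^+ 2 - a * z j <= chain z.
Proof.
move=> a0 jk; apply: (@le_trans _ _
    (\sum_(i < j) hinge (z i - z i.+1 - a) ^+ 2 / 2 - a * z 0)); last first.
  rewrite lerD2r (big_ord_widen k (fun i => hinge (z i - z i.+1 - a) ^+ 2 / 2))//.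
  rewrite [leRHS](bigID (fun i : 'I_k => (i < j)%N))/= lerDl.
  by apply: sumr_ge0 => i _; rewrite divr_ge0// sqr_ge0.
elim: j {jk} => [|j IH]; first by rewrite big_ord0 mulr0 mul0r.
rewrite big_ord_recr/= -natr1.
by have := hinge_young (z j - z j.+1) a0; lra.
Qed.

Lemma chain_min : 0 <= a ->
  chain (fun i => 2 * a * (k - i)%:R) = - (3 / 2) * k%:R * a ^+ 2.
Proof.
move=> a0; rewrite /chain (eq_bigr (fun=> a ^+ 2 / 2)) => [|i _]; last first.
  have -> : (k - i)%:R = (k - i.+1)%:R + 1 :> R.
    by rewrite natr1; congr (_%:R); have := ltn_ord i; lia.
  rewrite /hinge [X in Num.max X _](_ : _ = a) ?max_l//.
  by ring.
by rewrite sumr_const card_ord subn0 -mulr_natl; field.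
Qed.

Lemma eq_chain z z' : (forall i, (i <= k)%N -> z i = z' i) -> chain z = chain z'.
Proof.
move=> zz'; rewrite /chain zz'//; congr (_ - _); apply: eq_bigr => i _.
by rewrite !zz'// ltnW.
Qed.

Definition hard v x : R :=
  g * chain (fun i => dot (v i) x) + s / 2 * dot x x.

Definition hard_gradient v x : 'rV[R]_d :=
  g *: (\sum_(i < k) hinge (dot (v i - v i.+1) x - a) *: (v i - v i.+1) - a *: v 0)
  + s *: x.

Hypothesis g0 : 0 < g.

Lemma hard_remainder v x h :
  s / 2 * dot h h <= hard v (x + h) - hard v x - dot (hard_gradient v x) h <=
    g / 2 * \sum_(i < k) dot (v i - v i.+1) h ^+ 2 + s / 2 * dot h h.
Proof.
have -> : hard v (x + h) - hard v x - dot (hard_gradient v x) h =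
  g * (\sum_(i < k) (hinge (dot (v i - v i.+1) x - a + dot (v i - v i.+1) h) ^+ 2 / 2
      - hinge (dot (v i - v i.+1) x - a) ^+ 2 / 2
      - hinge (dot (v i - v i.+1) x - a) * dot (v i - v i.+1) h))
  + s / 2 * dot h h.
  rewrite /hard /hard_gradient /chain !dotDl dotZl dotBl dot_suml !dotZl !dotDr.
  rewrite (dotC h x) !sumrB.
  rewrite (eq_bigr (fun i : 'I_k => hinge (dot (v i - v i.+1) x - a +
    dot (v i - v i.+1) h) ^+ 2 / 2)); last first.
    by move=> i _; rewrite !dotE; congr (hinge _ ^+ 2 / 2); ring.
  rewrite [X in g * X + s / 2 * dot x x](_ : _ =
    \sum_(i < k) hinge (dot (v i - v i.+1) x - a) ^+ 2 / 2 - a * dot (v 0) x);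
    last first.
    by congr (_ - _); apply: eq_bigr => i _; rewrite dotBl.
  rewrite [X in g * (X - a * dot (v 0) h)](_ : _ = \sum_(i < k)
    hinge (dot (v i - v i.+1) x - a) * dot (v i - v i.+1) h); last first.
    by apply: eq_bigr => i _; rewrite dotZl.
  rewrite -[X in _ = g * (X - _ - _) + _]/(\sum_(i < k)
    hinge (dot (v i - v i.+1) x - a + dot (v i - v i.+1) h) ^+ 2 / 2).
  rewrite -[X in _ = g * (_ - X - _) + _]/(\sum_(i < k)
    hinge (dot (v i - v i.+1) x - a) ^+ 2 / 2).
  rewrite -[X in _ = g * (_ - _ - X) + _]/(\sum_(i < k)
    hinge (dot (v i - v i.+1) x - a) * dot (v i - v i.+1) h).
  by field.
apply/andP; split.
  rewrite lerDr; apply: mulr_ge0; first exact: ltW.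
  apply: sumr_ge0 => i _.
  by have /andP[] := hinge_remainder (dot (v i - v i.+1) x - a) (dot (v i - v i.+1) h).
rewrite lerD2r -mulrA ler_wpM2l ?(ltW g0)// mulr_sumr; apply: ler_sum => i _.
have /andP[_] := hinge_remainder (dot (v i - v i.+1) x - a) (dot (v i - v i.+1) h).
by move=> /le_trans; apply; rewrite mulrC.
Qed.

End Chain.

Lemma norm2Z (R : realType) (d : nat) (c : R) (x : 'rV[R]_d) :
  0 <= c -> norm2 (c *: x) = c * norm2 x.
Proof.
move=> c0; apply/eqP.
rewrite -(@eqrXn2 _ 2) ?norm2_ge0 ?mulr_ge0 ?norm2_ge0//.
by rewrite exprMn !sqr_norm2 !dotE mulrA expr2.
Qed.

Lemma compact_ball2 (R : realType) (d : nat) (r : R) : compact (@ball2 R d r).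
Proof.
apply: bounded_closed_compact.
  exists r; split; first exact: num_real.
  move=> M rM x /= xr.
  by rewrite (le_trans (mxnorm_le_norm2 x))// (le_trans xr)// ltW.
have -> : @ball2 R d r = (fun x => norm2 x) @^-1` [set t | t <= r] by [].
apply: closed_comp; last exact: closed_le.
move=> x _; rewrite /norm2.
apply: (@continuous_comp _ _ _ (fun y : 'rV[R]_d => \sum_(i < d) y 0 i ^+ 2) Num.sqrt);
  last exact: sqrt_continuous.
apply: (@continuous_big R _ +%R 0 xpredT) => [|i _ y]; first exact: add_continuous.
apply: (@continuous_comp _ _ _ (fun y : 'rV[R]_d => y 0 i) (fun t : R => t ^+ 2)).
  exact: coord_continuous.
exact: exprn_continuous.
Qed.

Lemma convex_of_tangents (R : realType) (d : nat) (f : 'rV[R]_d -> R)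
    (G : 'rV[R]_d -> 'rV[R]_d) :
  (forall x h, f x + dot (G x) h <= f (x + h)) ->
  @convex_function R 'rV[R]_d setT f.
Proof.
move=> fG t x y _ _.
set m := conv _ _ _.
suff : f m <= t%:num * f x + (1 - t%:num) * f y by [].
have mE : m = t%:num *: x + (1 - t%:num) *: y by [].
have t0 : 0 <= t%:num by [].
have t1 : 0 <= 1 - t%:num by rewrite subr_ge0.
have hx := ler_wpM2l t0 (fG m (x - m)).
have hy := ler_wpM2l t1 (fG m (y - m)).
rewrite !subrKC in hx hy.
have : t%:num * dot (G m) (x - m) + (1 - t%:num) * dot (G m) (y - m) = 0.
  by rewrite {2 4}mE !dotE; ring.
by lra.
Qed.

Section HardObjective.
Context {R : realType} {d : nat}.
Variables (g s a : R) (k : nat) (v : nat -> 'rV[R]_d).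
Hypotheses (g0 : 0 < g) (s0 : 0 < s) (a0 : 0 < a).
Hypothesis vO : forall i j, (i < k)%N -> (j < k)%N ->
  dot (v i) (v j) = (i == j)%:R.
Hypothesis vk : v k = 0.

Let f := hard g s a k v.
Let G := hard_gradient g s a k v.
Let x0 : 'rV[R]_d := \sum_(i < k) (2 * a * (k - i)%:R) *: v i.

Lemma hard_differentiable x : differentiable f x /\ gradient f x = G x.
Proof.
apply: (@gradient_of_quadratic_remainder _ _ _ _ _ (2 * g + s / 2)) => h.
have /andP[h1 h2] := hard_remainder s a k g0 v x h.
have hh : 0 <= s / 2 * dot h h by rewrite mulr_ge0 ?dot_ge0 ?divr_ge0 ?ltW.
rewrite ger0_norm ?(le_trans hh)// (le_trans h2)//.
have := ler_wpM2l (ltW g0) (Bessel_diff vO vk h).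
by lra.
Qed.

Lemma hard_tangent x h : f x + dot (G x) h + s / 2 * dot h h <= f (x + h).
Proof. by have /andP[h1 _] := hard_remainder s a k g0 v x h; rewrite /f /G; lra. Qed.

Lemma hard_gradient_lipschitz x y :
  norm2 (G x - G y) <= (4 * g + s) * norm2 (x - y).
Proof.
pose c i := hinge (dot (v i - v i.+1) x - a) - hinge (dot (v i - v i.+1) y - a).
pose w := \sum_(i < k) c i *: (v i - v i.+1).
have -> : G x - G y = g *: w + s *: (x - y).
  rewrite /G /hard_gradient /w /c.
  under [in RHS]eq_bigr do rewrite scalerBl.
  rewrite sumrB (scalerBr s) opprD addrACA -(scalerBr g); congr (g *: _ + _).
  by rewrite opprB addrA subrK.
rewrite (le_trans (ler_norm2D _ _))// !norm2Z ?(ltW g0) ?(ltW s0)//.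
rewrite mulrDl lerD2r -mulrA mulrCA ler_wpM2l ?(ltW g0)//.
rewrite norm2_le_dot; last by rewrite mulr_ge0// norm2_ge0.
rewrite exprMn sqr_norm2 (le_trans (Bessel_diff_dual vO vk _))//.
have -> : 4 ^+ 2 * dot (x - y) (x - y) = 4 * (4 * dot (x - y) (x - y)) by ring.
rewrite ler_wpM2l// (le_trans _ (Bessel_diff vO vk _))//.
apply: ler_sum => i _; rewrite (le_trans (hinge_lipschitz _ _))//.
by rewrite [X in X ^+ 2](_ : _ = dot (v i - v i.+1) (x - y))// !dotE; ring.
Qed.

Lemma dot_x0 i : (i <= k)%N -> dot (v i) x0 = 2 * a * (k - i)%:R.
Proof.
rewrite leq_eqVlt => /predU1P[->|ik]; first by rewrite vk dot0l subnn mulr0.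
exact: (@dot_orthonormal_sum _ _ _ _ vO (fun i => 2 * a * (k - i)%:R)).
Qed.

Lemma hard_x0 : f x0 = - g * (3 / 2 * k%:R * a ^+ 2) + s / 2 * dot x0 x0.
Proof.
rewrite /f /hard (eq_chain a dot_x0) chain_min ?(ltW a0)//; ring.
Qed.

Lemma dot_x0_le : dot x0 x0 <= 4 * a ^+ 2 * k%:R ^+ 3.
Proof.
rewrite (@dot_orthonormal_sum2 _ _ _ _ vO (fun i => 2 * a * (k - i)%:R)).
apply: (@le_trans _ _ (\sum_(i < k) (2 * a * k%:R) ^+ 2)).
  apply: ler_sum => i _; rewrite lerXn2r ?nnegrE ?mulr_ge0 ?(ltW a0)//.
  by rewrite ler_wpM2l ?mulr_ge0 ?(ltW a0)// ler_nat leq_subr.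
by rewrite sumr_const card_ord -mulr_natr le_eqVlt; apply/orP; left; apply/eqP; ring.
Qed.

Lemma hard_ge x : - g * (3 / 2 * k%:R * a ^+ 2) + s / 2 * dot x x <= f x.
Proof.
have := chain_ge (fun i => dot (v i) x) (ltW a0) (leqnn k).
rewrite /= vk dot0l mulr0 subr0 => /(ler_wpM2l (ltW g0)).
by rewrite /f /hard; lra.
Qed.

Lemma hard_objective r beta : 0 <= r -> 4 * g + s <= beta ->
  4 * a ^+ 2 * k%:R ^+ 3 <= (r / 2) ^+ 2 -> objective r beta f.
Proof.
move=> r0 gsb ar.
have fd x : differentiable f x by have [] := hard_differentiable x.
have fG x : gradient f x = G x by have [] := hard_differentiable x.
have fL x y : norm2 (gradient f x - gradient f y) <= beta * norm2 (x - y).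
  rewrite !fG (le_trans (hard_gradient_lipschitz x y))//.
  by rewrite ler_wpM2r// norm2_ge0.
have beta0 : 0 <= beta by move: g0 s0; lra.
split=> //.
- apply: (@convex_of_tangents _ _ _ G) => x h.
  have := hard_tangent x h.
  by have : 0 <= s / 2 * dot h h; [rewrite mulr_ge0 ?dot_ge0 ?divr_ge0 ?ltW|lra].
- exact: (lipschitz_norm2_continuous beta0 fL).
have x0b : ball2 (r / 2) x0.
  by rewrite /ball2/= norm2_le_dot ?divr_ge0// (le_trans dot_x0_le).
have [c cb fc] : exists2 c, c \in ball2 (r / 2) &
    forall t, t \in ball2 (r / 2) -> f c <= f t.
  apply: compact_EVT_min; [by exists x0 | exact: compact_ball2 |].
  by apply: continuous_subspaceT => x; exact: differentiable_continuous.
have cmin : minimizers f c.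
  move=> y; have [yb|yb] := leP (norm2 y) (r / 2).
    by apply: fc; rewrite inE.
  apply: (@le_trans _ _ (f x0)); first by apply: fc; rewrite inE.
  rewrite hard_x0 (le_trans _ (hard_ge y))// lerD2l ler_wpM2l ?divr_ge0 ?(ltW s0)//.
  rewrite (le_trans dot_x0_le)// (le_trans ar)// -sqr_norm2.
  by rewrite lerXn2r ?nnegrE ?divr_ge0 ?norm2_ge0// ltW.
exists c; first by move: cb; rewrite inE.
split=> // y ymin; apply/eqP; rewrite -subr_eq0; apply/eqP/dot_eq0.
pose m := 2^-1 *: (c + y); pose h := 2^-1 *: (c - y).
have mc : m + h = c by apply/rowP => i; rewrite !mxE; field.
have my : m + - h = y by apply/rowP => i; rewrite !mxE; field.
have h1 := hard_tangent m h; have h2 := hard_tangent m (- h).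
rewrite mc in h1; rewrite my in h2; rewrite !dotNr dotNl opprK in h2.
have h3 := cmin m; have h4 := ymin m.
have hE : dot h h = dot (c - y) (c - y) / 4.
  by rewrite dotZl dotZr mulrA -invfM mulrC; congr (_ / _); ring.
have : s / 2 * dot h h <= 0 by lra.
rewrite pmulr_rle0 ?divr_gt0// hE => h5.
by apply/eqP; rewrite eq_le dot_ge0 andbT; lra.
Qed.

Lemma hard_gap x r beta j : 0 <= r -> 4 * g + s <= beta ->
  4 * a ^+ 2 * k%:R ^+ 3 <= (r / 2) ^+ 2 ->
  (j <= k)%N -> dot (v j) x <= a / 2 ->
  g * a ^+ 2 * (3 / 2 * (k - j)%:R - 1 / 2) - s * r ^+ 2 / 8 <= f x - min_value f.
Proof.
move=> r0 gsb ar jk vjx.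
have [c _ [cmin _]] := objective_minimizer (hard_objective r0 gsb ar).
rewrite (min_value_attained cmin).
have h1 : f c <= - g * (3 / 2 * k%:R * a ^+ 2) + s / 2 * (r / 2) ^+ 2.
  rewrite (le_trans (cmin x0))// hard_x0 lerD2l ler_wpM2l ?divr_ge0 ?(ltW s0)//.
  by rewrite (le_trans dot_x0_le).
have h2 := ler_wpM2l (ltW g0) (chain_ge (fun i => dot (v i) x) (ltW a0) jk).
have h3 : g * (a * dot (v j) x) <= g * (a * (a / 2)).
  by rewrite !ler_wpM2l ?(ltW g0) ?(ltW a0).
have h4 : 0 <= s / 2 * dot x x by rewrite mulr_ge0 ?dot_ge0 ?divr_ge0 ?ltW.
have fx : f x = g * chain a k (fun i => dot (v i) x) + s / 2 * dot x x by [].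
rewrite natrB// fx; rewrite /= in h2.
by lra.
Qed.

End HardObjective.

(** * The resisting oracle *)

Section ResistingOracle.
Context {R : realType} {d : nat} {r : R} {T : nat}.
Variable A : algorithm d r T.

(* The output is treated as a query of index [T]. *)
Definition queried (f : 'rV[R]_d -> R) (t : nat) : 'rV[R]_d :=
  if (t < T)%N then query A (transcript A f t) else run A f.

Lemma transcript_eq f1 f2 n :
  (forall t, (t < T)%N -> (t < n)%N -> f1 (queried f1 t) = f2 (queried f1 t)) ->
  forall t, (t <= T)%N -> (t <= n)%N -> transcript A f1 t = transcript A f2 t.
Proof.
move=> f12; elim=> [//|t IH] tT tn /=.
have := f12 t tT tn; rewrite /queried tT IH ?(ltnW tT) ?(ltnW tn)// => fE.
by apply: val_inj => /=; rewrite fE.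
Qed.

Lemma queried_eq f1 f2 n :
  (forall t, (t < T)%N -> (t < n)%N -> f1 (queried f1 t) = f2 (queried f1 t)) ->
  forall t, (t <= T)%N -> (t <= n)%N -> queried f1 t = queried f2 t.
Proof.
move=> /transcript_eq f12 t tT tn; rewrite /queried; case: ifPn => [_|].
  by rewrite f12.
rewrite -leqNgt => Tt; have tE : t = T by apply/eqP; rewrite eqn_leq tT Tt.
by rewrite /run f12 -?tE.
Qed.

Lemma queried_ball f t : ball2 r (queried f t).
Proof.
have trB u : (u <= T)%N -> transcripts r u (transcript A f u).
  elim: u => [_ [//]|u IH uT i].
  have uB := IH (ltnW uT).
  rewrite (tnth_nth (tnth (transcript A f u.+1) i)) /= nth_rcons size_tuple.
  have := ltn_ord i; rewrite ltnS leq_eqVlt => /predU1P[->|iu].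
    by rewrite ltnn eqxx /=; exact: (query_borel A uT).2.
  rewrite iu -[i : nat]/(Ordinal iu : nat) -tnth_nth.
  exact: uB.
rewrite /queried; case: ifPn => tT.
  by apply: (query_borel A tT).2; apply: trB; exact: ltnW.
by apply: (output_borel A).2; exact: trB.
Qed.

Variables (g s a lam : R) (k m n : nat).
Hypotheses (r0 : 0 < r) (a0 : 0 < a) (lam0 : 0 < lam) (n0 : (0 < n)%N).
Hypothesis dimd : (m + k + n <= d)%N.
Hypothesis lamT : (2 * T.+1)%:R <= expR lam.
Hypothesis flat : 8 * r ^+ 2 * lam / n%:R <= (a / 2) ^+ 2.

Lemma hard_update (v v' : nat -> 'rV[R]_d) i x :
  (forall j, j != i -> v' j = v j) -> v i = 0 -> v i.+1 = 0 ->
  (dot (v' i) x = 0 \/ [/\ (0 < i)%N, `|dot (v i.-1) x| <= a / 2 &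
                           `|dot (v' i) x| <= a / 2]) ->
  hard g s a k v x = hard g s a k v' x.
Proof.
move=> vv' vi vi1 H; rewrite /hard; congr (g * _ + _); rewrite /chain.
case: H => [v'0|[i0 zi1 zi]].
  have zE j : dot (v' j) x = dot (v j) x.
    by have [->|/vv' ->//] := eqVneq j i; rewrite v'0 vi dot0l.
  by congr (_ - _); rewrite ?zE//; apply: eq_bigr => j _; rewrite !zE.
rewrite (vv' 0%N); last by rewrite neq_ltn i0.
congr (_ - _); apply: eq_bigr => j _.
have [ji|ji] := eqVneq (j : nat) i.
  rewrite ji vi vi1 (vv' i.+1) ?vi1 ?dot0l; last by rewrite neq_ltn ltnSn orbT.
  move: zi; rewrite ler_norml => /andP[z1 z2].
  by rewrite !hinge_eq0//; lra.
have [ji1|ji1] := eqVneq (j.+1 : nat) i.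
  have ji2 : (j : nat) = i.-1 by rewrite -ji1.
  rewrite ji1 ji2 vi (vv' i.-1) ?dot0l; last first.
    by rewrite neq_ltn prednK// leqnn.
  move: zi zi1; rewrite !ler_norml => /andP[z1 z2] /andP[z3 z4].
  by rewrite !hinge_eq0//; lra.
by rewrite !vv'.
Qed.

Lemma resisting_directions i : (i <= k)%N ->
  exists v : nat -> 'rV[R]_d,
    [/\ forall p q, (p < i)%N -> (q < i)%N -> dot (v p) (v q) = (p == q)%:R,
        forall p, (i <= p)%N -> v p = 0 &
        forall p t, (p < i)%N -> (t <= T)%N -> (t < p.+1 * m)%N ->
          `|dot (v p) (queried (hard g s a k v) t)| <= a / 2].
Proof.
elim: i => [_|i IH ik]; first by exists (fun=> 0).
have [v [vO v0 vq]] := IH (ltnW ik).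
pose x t := queried (hard g s a k v) t.
pose S := [seq x t | t <- iota (i * m) m] ++ [seq v j | j <- iota 0 i].
pose P := [seq x t | t <- iota 0 T.+1].
have sS : (size S + n <= d)%N.
  by rewrite size_cat !size_map !size_iota; lia.
have lamP : (2 * size P)%:R <= expR lam by rewrite size_map size_iota.
have Pr p : p \in P -> dot p p <= r ^+ 2.
  by move=> /mapP[t _ ->]; rewrite -norm2_le_dot ?(ltW r0)//; exact: queried_ball.
have [u [uu uS uP]] := exists_flat_direction r0 lam0 n0 sS lamP Pr.
have ux t : (t <= T)%N -> `|dot u (x t)| <= a / 2.
  move=> tT; rewrite -ler_sqr ?nnegrE ?divr_ge0 ?(ltW a0)//.
  rewrite real_normK ?num_real// (le_trans _ flat)// uP//.
  by apply: map_f; rewrite mem_iota.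
have uv j : (j < i)%N -> dot u (v j) = 0.
  by move=> ji; apply: uS; rewrite mem_cat map_f ?orbT// mem_iota.
pose v' j := if j == i then u else v j.
have v'i : v' i = u by rewrite /v' eqxx.
have v'j j : j != i -> v' j = v j by rewrite /v' => /negPf ->.
have agree t : (t <= T)%N -> (t < i.+1 * m)%N ->
    hard g s a k v (x t) = hard g s a k v' (x t).
  move=> tT ti; apply: (@hard_update v v' i _ v'j (v0 _ (leqnn i)) (v0 _ (leqnSn i))).
  rewrite v'i.
  have [it|it] := leqP (i * m) t.
    left; apply: uS; rewrite mem_cat map_f// mem_iota it/=.
    by rewrite mulSn addnC in ti.
  right; have i0 : (0 < i)%N by case: (i) it.
  by split=> //; [apply: vq; rewrite ?prednK | exact: ux].
have xE t : (t <= T)%N -> (t <= i.+1 * m)%N ->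
    queried (hard g s a k v') t = x t.
  move=> tT ti; apply/esym.
  apply: (@queried_eq _ _ (i.+1 * m)) => // t' t'T t'i.
  exact: agree (ltnW t'T) t'i.
exists v'; split.
- move=> p q; rewrite ltnS leq_eqVlt => /predU1P[->|pi];
    rewrite ltnS leq_eqVlt => /predU1P[->|qi].
  + by rewrite v'i uu eqxx.
  + by rewrite v'i (v'j q) ?(ltn_eqF qi)// uv// (gtn_eqF qi).
  + by rewrite v'i (v'j p) ?(ltn_eqF pi)// dotC uv.
  + by rewrite (v'j p) ?(ltn_eqF pi)// (v'j q) ?(ltn_eqF qi)// vO.
- by move=> p ip; rewrite v'j ?gtn_eqF// v0// ltnW.
- move=> p t pi tT tp.
  have ti : (t < i.+1 * m)%N by rewrite (leq_trans tp)// leq_mul2r pi orbT.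
  rewrite xE// ?(ltnW ti)//.
  move: pi; rewrite ltnS leq_eqVlt => /predU1P[->|pi]; first by rewrite v'i ux.
  by rewrite v'j ?ltn_eqF// vq.
Qed.

End ResistingOracle.

Lemma exists_hard_objective (R : realType) (d : nat) (r beta lam : R)
    (T K m n : nat) (A : algorithm d r T) :
  0 < r -> 0 < beta -> 0 < lam -> (0 < n)%N -> (0 < K)%N ->
  (m + 2 * K + n <= d)%N -> (T < K * m)%N ->
  (2 * T.+1)%:R <= expR lam ->
  4096 * K%:R ^+ 3 * lam <= n%:R ->
  exists2 f, objective r beta f &
    beta * r ^+ 2 / (2048 * K%:R ^+ 2) <= f (run A f) - min_value f.
Proof.
move=> r0 beta0 lam0 n0 K0 dimd TKm lamT flat.
have K2K : (K < 2 * K)%N by rewrite ltn_Pmull.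
have KR : 1 <= K%:R :> R by rewrite ler1n.
have KR0 : 0 < K%:R :> R by rewrite ltr0n.
have K30 : 0 < K%:R ^+ 3 :> R by rewrite exprn_gt0.
pose a := r / Num.sqrt (128 * K%:R ^+ 3).
have a2 : a ^+ 2 = r ^+ 2 / (128 * K%:R ^+ 3).
  by rewrite exprMn exprVn sqr_sqrtr// mulr_ge0 ?ler0n// ltW.
have a0 : 0 < a by rewrite divr_gt0// sqrtr_gt0 mulr_gt0 ?ltr0n.
pose g := beta / 8; pose s := g / (32 * K%:R ^+ 2).
have g0 : 0 < g by rewrite divr_gt0.
have K20 : 0 < 32 * K%:R ^+ 2 :> R by rewrite mulr_gt0// exprn_gt0.
have s0 : 0 < s by rewrite divr_gt0.
have flat' : 8 * r ^+ 2 * lam / n%:R <= (a / 2) ^+ 2.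
  rewrite exprMn a2 ler_pdivrMr ?ltr0n//.
  rewrite [leRHS](_ : _ = r ^+ 2 / (512 * K%:R ^+ 3) * n%:R); last first.
    by field; rewrite !gt_eqF.
  rewrite [leRHS]mulrAC ler_pdivlMr ?(mulr_gt0 _ K30) ?ltr0n//.
  have := ler_wpM2l (sqr_ge0 r) flat; lra.
have [v [vO v0 vq]] := resisting_directions A g s r0 a0 lam0 n0 dimd lamT flat'
  (leqnn (2 * K)%N).
have sg : s <= g.
  rewrite ler_pdivrMr// ler_peMr ?(ltW g0)//.
  have : 1 <= K%:R ^+ 2 :> R by rewrite exprn_ege1.
  by lra.
have gsb : 4 * g + s <= beta by move: sg; rewrite /g; lra.
have ar : 4 * a ^+ 2 * (2 * K)%N%:R ^+ 3 <= (r / 2) ^+ 2.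
  rewrite a2 natrM le_eqVlt; apply/orP; left; apply/eqP.
  by field; rewrite gt_eqF.
have vk : v (2 * K)%N = 0 by exact: v0.
exists (hard g s a (2 * K) v).
  exact: hard_objective g0 s0 a0 vO vk _ _ (ltW r0) gsb ar.
have xq : dot (v K) (run A (hard g s a (2 * K) v)) <= a / 2.
  have := vq K T; rewrite /queried ltnn ler_norml.
  rewrite K2K.
  have -> : (T < K.+1 * m)%N by rewrite (leq_trans TKm)// leq_mul2r leqnSn orbT.
  by move=> /(_ isT (leqnn _) isT)/andP[].
have := hard_gap g0 s0 a0 vO vk (ltW r0) gsb ar (ltnW K2K) xq.
apply: le_trans.
have -> : (2 * K - K)%N = K by rewrite mul2n -addnn addnK.
have -> : g * a ^+ 2 * (3 / 2 * K%:R - 1 / 2) =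
   g * a ^+ 2 * K%:R + g * a ^+ 2 / 2 * (K%:R - 1) by field.
have h1 : 0 <= g * a ^+ 2 / 2 * (K%:R - 1).
  by rewrite mulr_ge0 ?subr_ge0// divr_ge0// mulr_ge0 ?sqr_ge0// ltW.
have -> : g * a ^+ 2 * K%:R = 2 * (beta * r ^+ 2 / (2048 * K%:R ^+ 2)).
  by rewrite a2 /g; field; rewrite gt_eqF.
have -> : s * r ^+ 2 / 8 = beta * r ^+ 2 / (2048 * K%:R ^+ 2).
  by rewrite /s /g; field; rewrite gt_eqF.
lra.
Qed.

Lemma worst_case_gapP (R : realType) (d : nat) (r beta eps : R) (T : nat)
    (A : algorithm d r T) :
  (worst_case_gap beta A <= eps%:E)%E <->
  forall f, objective r beta f -> f (run A f) - min_value f <= eps.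
Proof.
split=> [h f fo|h].
  by rewrite -lee_fin; apply: le_trans h; apply: ereal_sup_ubound; exists f.
by apply: ge_ereal_sup => _ [f fo <-]; rewrite lee_fin; exact: h.
Qed.

Lemma cube_le_of_powR_le (R : realType) (x q : R) : 0 < x -> 0 < q ->
  x `^ (2 / 3) <= q ^- 2 -> q ^+ 3 * x <= 1.
Proof.
move=> x0 q0 h.
have x2 : x ^+ 2 = (x `^ (2 / 3)) ^+ 3.
  rewrite -[RHS]powR_mulrn ?powR_ge0// -powRrM.
  by rewrite (_ : 2 / 3 * 3%:R = 2%:R) ?powR_mulrn ?ltW//; field.
have q30 : 0 < q ^+ 3 by rewrite exprn_gt0.
have qx0 : 0 <= q ^+ 3 * x by rewrite mulr_ge0// ltW.
rewrite -ler_sqr ?nnegrE ?ler01// expr1n exprMn x2.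
rewrite -exprM (mulnC 3) exprM -exprMn exprn_ile1//.
  by rewrite mulr_ge0 ?sqr_ge0 ?powR_ge0.
by rewrite mulrC -ler_pdivlMr ?exprn_gt0// div1r.
Qed.

Lemma complexity_lower_bound (R : realType) (d : nat) (r beta eps : R) :
  0 < r -> 0 < beta -> 0 < eps -> (8 <= d)%N ->
  beta * r ^+ 2 * (ln (expR 1 * d%:R) / d%:R) `^ (2 / 3) <= eps ->
  eps <= 4096^-1 * (beta * r ^+ 2) ->
  ((1024^-1 * d%:R * Num.sqrt (beta * r ^+ 2 / eps))%:E
     <= det_ad_complexity d r beta eps)%E.
Proof.
move=> r0 beta0 eps0 d8 lo hi.
have d0 : (0 < d)%N by exact: leq_trans d8.
have br0 : 0 < beta * r ^+ 2 by rewrite mulr_gt0// exprn_gt0.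
set q := Num.sqrt _.
have q2 : q ^+ 2 = beta * r ^+ 2 / eps by rewrite sqr_sqrtr// ltW// divr_gt0.
have q0 : 0 < q by rewrite sqrtr_gt0 divr_gt0.
have q64 : 64 <= q.
  rewrite -ler_sqr ?nnegrE ?(ltW q0)// q2 ler_pdivlMr//; lra.
clear hi.
have dR : 0 < d%:R :> R by rewrite ltr0n.
set L := ln (expR 1 * d%:R) in lo.
have L1 : 1 <= L.
  by rewrite /L lnM ?posrE ?expR_gt0// expRK lerDl ln_ge0// ler1n.
have L0 : 0 < L by exact: lt_le_trans L1.
have q3L : q ^+ 3 * L <= d%:R.
  have := @cube_le_of_powR_le R (L / d%:R) q (divr_gt0 L0 dR) q0.
  rewrite mulrA ler_pdivrMr// mul1r; apply.
  by rewrite q2 invf_div ler_pdivlMr// mulrC.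
pose K := Num.truncn (q / 64).
have /andP[Kle Kgt] : K%:R <= q / 64 < K.+1%:R by apply: truncn_itv; lra.
have K0 : (0 < K)%N by rewrite truncn_ge_nat; lra.
have KR1 : 1 <= K%:R :> R by rewrite ler1n.
have KqR : q / 128 <= K%:R by move: Kgt; rewrite -(natr1 K); lra.
have K3 : K%:R ^+ 3 * L <= d%:R / 64 ^+ 3.
  apply: (@le_trans _ _ ((q / 64) ^+ 3 * L)).
    rewrite ler_wpM2r ?(ltW L0)//.
    by rewrite lerXn2r ?nnegrE// divr_ge0// ltW.
  by move: q3L; lra.
have KK3 : K%:R <= K%:R ^+ 3 * L.
  rewrite -[leLHS]mulr1 ler_pM//.
  by rewrite -[leLHS]expr1 ler_weXn2l.
have Kd : (4 * K <= d)%N by rewrite -(ler_nat R) natrM; lra.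
have dm : (d <= 8 * (d %/ 4))%N by move: d8; clear; lia.
have dmR : d%:R / 8 <= (d %/ 4)%N%:R :> R.
  by move: dm; rewrite -(ler_nat R) natrM; lra.
apply: le_ereal_inf_tmp => _ [T [A AT] <-].
rewrite lee_fin leNgt; apply/negP => Tlt.
have TKm : (T < K * (d %/ 4))%N.
  rewrite -(ltr_nat R) (lt_le_trans Tlt)// natrM.
  apply: (@le_trans _ _ (q / 128 * (d%:R / 8))); first by lra.
  by rewrite ler_pM// divr_ge0 ?ltW.
have T2 : (2 * T.+1)%:R <= expR (2 * L).
  rewrite mulrC mulr_natr mulr2n expRD lnK ?posrE ?mulr_gt0 ?expR_gt0//.
  have e2 : 2 <= expR 1 :> R by have := @expR_ge1Dx R 1; lra.
  have Td : T.+1%:R <= d%:R * d%:R :> R.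
    by rewrite -natrM ler_nat (leq_trans TKm)// leq_mul ?leq_div//
      (leq_trans _ Kd)// leq_pmull.
  rewrite natrM mulrACA ler_pM// -[2]mulr1.
  by rewrite ler_pM//; lra.
have L20 : 0 < 2 * L by lra.
have n0 : (0 < d %/ 4)%N by move: d8; clear; lia.
have dims : (d %/ 4 + 2 * K + d %/ 4 <= d)%N by move: Kd; clear; lia.
have flat : 4096 * K%:R ^+ 3 * (2 * L) <= (d %/ 4)%N%:R by lra.
have [f fo] := exists_hard_objective A r0 beta0 L20 n0 K0 dims TKm T2 flat.
rewrite leNgt => /negP; apply.
have := (worst_case_gapP beta eps A).1 AT _ fo => /le_lt_trans; apply.
have p0 : 0 < 2048 * K%:R ^+ 2 :> R by rewrite mulr_gt0 ?exprn_gt0 ?ltr0n.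
rewrite (ltr_pdivlMr _ _ p0).
have K2 : K%:R ^+ 2 <= (q / 64) ^+ 2.
  by rewrite lerXn2r ?nnegrE// divr_ge0// ltW.
have : K%:R ^+ 2 * (4096 * eps) <= beta * r ^+ 2.
  have p1 : 0 < 4096 * eps by rewrite mulr_gt0 ?ltr0n.
  rewrite -(ler_pdivlMr _ _ p1) (le_trans K2)// exprMn q2.
  by rewrite le_eqVlt; apply/orP; left; apply/eqP; field; rewrite gt_eqF.
by move: br0; clear; lra.
Qed.

(** * Accelerated gradient descent with finite differences *)

Section Projection.
Context {R : realType} {d : nat}.
Implicit Types x w : 'rV[R]_d.

Definition proj_ball (rho : R) x : 'rV[R]_d := (rho / Num.max rho (norm2 x)) *: x.

Lemma norm2_proj_ball rho x : 0 < rho -> norm2 (proj_ball rho x) <= rho.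
Proof.
move=> rho0; have m0 : 0 < Num.max rho (norm2 x) by rewrite lt_max rho0.
rewrite norm2Z; last by rewrite divr_ge0// ltW.
by rewrite mulrAC ler_pdivrMr// ler_wpM2l ?(ltW rho0)// le_max lexx orbT.
Qed.

Lemma proj_ball_obtuse rho x w : 0 < rho -> norm2 w <= rho ->
  0 <= dot (proj_ball rho x - x) (w - proj_ball rho x).
Proof.
move=> rho0 wr; rewrite /proj_ball; case: (lerP (norm2 x) rho) => xr.
  by rewrite divff ?gt_eqF// scale1r subrr dot0l.
have N0 : 0 < norm2 x by exact: lt_trans xr.
set c := rho / norm2 x.
have c1 : c <= 1 by rewrite ler_pdivrMr// mul1r ltW.
have xE : dot x x = norm2 x ^+ 2 by rewrite sqr_norm2.
have -> : dot (c *: x - x) (w - c *: x) = (1 - c) * (rho * norm2 x - dot x w).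
  by rewrite !dotE xE /c; field; rewrite gt_eqF.
rewrite mulr_ge0 ?subr_ge0// (le_trans (Cauchy_Schwarz _ _))//.
by rewrite mulrC ler_wpM2r// ltW.
Qed.

End Projection.

Section AcceleratedStep.
Context {R : realType} {d : nat}.
Variables (f : 'rV[R]_d -> R) (G : 'rV[R]_d -> 'rV[R]_d) (beta rho : R).
Hypotheses (beta0 : 0 < beta) (rho0 : 0 < rho).
Hypothesis f_tangent : forall x y, f x + dot (G x) (y - x) <= f y.
Hypothesis f_smooth : forall x v, f (x + v) <= f x + dot (G x) v + beta * dot v v.

Lemma accelerated_step (x z g w : 'rV[R]_d) (th del : R) :
  0 < th <= 1 -> norm2 w <= rho ->
  let y := (1 - th) *: x + th *: z in
  let z' := proj_ball rho (z - (2 * beta * th)^-1 *: g) in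
  dot (G y - g) (z' - w) <= del ->
  f ((1 - th) *: x + th *: z') - f w <=
    (1 - th) * (f x - f w) +
    beta * th ^+ 2 * (dot (w - z) (w - z) - dot (w - z') (w - z')) + th * del.
Proof.
move=> /andP[th0 th1] wr y z' hdel.
have bt0 : 0 < 2 * beta * th by rewrite !mulr_gt0.
have := proj_ball_obtuse (z - (2 * beta * th)^-1 *: g) rho0 wr.
rewrite -/z' => hpr; clearbody z'.
have x'E : y + th *: (z' - z) = (1 - th) *: x + th *: z'.
  by apply/rowP => i; rewrite !mxE; ring.
have hy : dot (G y) y = (1 - th) * dot (G y) x + th * dot (G y) z.
  by rewrite {2}/y !dotE.
clearbody y.
have hw := f_tangent y w; have hx := f_tangent y x.
have hs := f_smooth y (th *: (z' - z)); rewrite x'E in hs.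
have hproj : dot g (z' - w) <=
    beta * th * (dot (w - z) (w - z) - dot (w - z') (w - z')
      - dot (z' - z) (z' - z)).
  move: hpr => /(mulr_ge0 (ltW bt0)).
  have -> : z' - (z - (2 * beta * th)^-1 *: g) = (2 * beta * th)^-1 *: g + (z' - z).
    by rewrite opprB addrCA.
  rewrite (dotDl _ (z' - z)) dotZl mulrDr mulrA divff ?gt_eqF// mul1r.
  by rewrite !dotE (dotC w z) (dotC w z') (dotC z z'); lra.
have hth := ler_wpM2l (ltW th0) hproj.
have hdelth := ler_wpM2l (ltW th0) hdel.
have hwt := ler_wpM2l (ltW th0) hw.
have th1' : 0 <= 1 - th by rewrite subr_ge0.
have hxt := ler_wpM2l th1' hx.
move: hs hth hdelth hwt hxt hy; clear.
rewrite !dotE; lra.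
Qed.

End AcceleratedStep.

Section FiniteDifferenceMethod.
Context {R : realType} {d : nat}.
Variables (r beta h : R).
Implicit Types u : nat -> R.

Definition momentum (k : nat) : R := 2 / k.+2%:R.

Definition difference_quotients u (b : nat) : 'rV[R]_d :=
  \row_(i < d) ((u (b + i.+1)%N - u b) / h).

(* [u i] is the value observed at the [i]-th query, and iteration [k] consumes
   the [d.+1] values starting at [k * d.+1]. *)
Fixpoint states u (k : nat) : 'rV[R]_d * 'rV[R]_d :=
  if k is k'.+1 then
    let: (x, z) := states u k' in
    let th := momentum k' in
    let z' := proj_ball (r / 2)
      (z - (2 * beta * th)^-1 *: difference_quotients u (k' * d.+1)) in
    ((1 - th) *: x + th *: z', z')
  else (0, 0).

Definition base_point u k : 'rV[R]_d :=
  let: (x, z) := states u k in (1 - momentum k) *: x + momentum k *: z.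

Definition probe u (t : nat) : 'rV[R]_d :=
  base_point u (t %/ d.+1)%N + \row_(i < d) (h *+ (t %% d.+1 == i.+1)%N).

Lemma states_ext u u' k : (forall i, (i < k * d.+1)%N -> u i = u' i) ->
  states u k = states u' k.
Proof.
elim: k => //= k IH uu'.
have -> : states u k = states u' k by apply: IH => i ik; apply: uu'; lia.
suff -> : difference_quotients u (k * d.+1) = difference_quotients u' (k * d.+1) by [].
apply/rowP => i; rewrite !mxE !uu'//; have := ltn_ord i; lia.
Qed.

Lemma probe_ext u u' t : (forall i, (i < t)%N -> u i = u' i) -> probe u t = probe u' t.
Proof.
move=> uu'; rewrite /probe /base_point (states_ext (u' := u'))// => i it.
by apply: uu'; apply: leq_trans it _; exact: leq_trunc_div.
Qed.

Hypotheses (r0 : 0 < r) (beta0 : 0 < beta) (h0 : 0 < h) (hr : h <= r / 2).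

Lemma momentum_itv k : 0 < momentum k <= 1.
Proof.
by rewrite divr_gt0//= ler_pdivrMr// mul1r ler_nat.
Qed.

Lemma norm2_combination (t c : R) (x y : 'rV[R]_d) : 0 <= t <= 1 ->
  norm2 x <= c -> norm2 y <= c -> norm2 ((1 - t) *: x + t *: y) <= c.
Proof.
move=> /andP[t0 t1] xc yc; have t1' : 0 <= 1 - t by rewrite subr_ge0.
rewrite (le_trans (ler_norm2D _ _))// !norm2Z//.
by have := ler_wpM2l t0 yc; have := ler_wpM2l t1' xc; lra.
Qed.

Lemma norm2_0 : norm2 (0 : 'rV[R]_d) = 0.
Proof. by rewrite -(scale0r 0) norm2Z// mul0r. Qed.

Lemma norm2_states u k :
  norm2 (states u k).1 <= r / 2 /\ norm2 (states u k).2 <= r / 2.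
Proof.
have r20 : 0 < r / 2 by rewrite divr_gt0.
elim: k => [|k] /=; first by rewrite norm2_0 ltW.
case: (states u k) => x z [xr zr]; split=> /=; last exact: norm2_proj_ball.
apply: norm2_combination => //; last exact: norm2_proj_ball.
by have /andP[/ltW -> ->] := momentum_itv k.
Qed.

Lemma norm2_base_point u k : norm2 (base_point u k) <= r / 2.
Proof.
rewrite /base_point; have := norm2_states u k.
case: (states u k) => x z [xr zr]; apply: norm2_combination => //.
by have /andP[/ltW -> ->] := momentum_itv k.
Qed.

Lemma probe_base u k : probe u (k * d.+1) = base_point u k.
Proof.
rewrite /probe mulnK// modnMl [X in _ + X](_ : _ = 0) ?addr0//.
by apply/rowP => i; rewrite !mxE.
Qed.

Lemma probe_coord u k (i : 'I_d) :
  probe u (k * d.+1 + i.+1) = base_point u k + h *: delta_mx 0 i.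
Proof.
have id : (i.+1 < d.+1)%N by rewrite ltnS.
rewrite /probe divnMDl// divn_small// addn0 modnMDl modn_small//; congr (_ + _).
apply/rowP => j; rewrite !mxE eqxx /= eqSS eq_sym.
by rewrite -[_ == _ :> nat]/(j == i); case: eqP; rewrite ?mulr1 ?mulr0.
Qed.

Lemma norm2_probe u t : norm2 (probe u t) <= r.
Proof.
rewrite (divn_eq t d.+1); case E : (t %% d.+1)%N => [|j].
  rewrite addn0 probe_base (le_trans (norm2_base_point _ _))//.
  by have := ltW r0; lra.
have jd : (j < d)%N by rewrite -ltnS -E ltn_pmod.
rewrite (probe_coord u _ (Ordinal jd)) (le_trans (ler_norm2D _ _))//.
rewrite norm2Z ?(ltW h0)// (_ : norm2 (delta_mx 0 _) = 1) ?mulr1; last first.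
  apply/eqP; rewrite -(@eqrXn2 _ 2) ?norm2_ge0// sqr_norm2 dot_delta mxE.
  by rewrite !eqxx expr1n.
rewrite (le_trans (lerD (norm2_base_point _ _) hr))//.
by lra.
Qed.

End FiniteDifferenceMethod.

Section Convergence.
Context {R : realType} {d : nat}.
Variables (r beta h : R) (f : 'rV[R]_d -> R).
Hypotheses (r0 : 0 < r) (beta0 : 0 < beta) (h0 : 0 < h) (hr : h <= r / 2).
Hypothesis fo : objective r beta f.
Variables (u : nat -> R) (N : nat).
Hypothesis uf : forall i, (i < N * d.+1)%N -> u i = f (probe r beta h u i).

Lemma difference_quotients_error k (v : 'rV[R]_d) : (k < N)%N -> norm2 v <= r ->
  dot (gradient f (base_point r beta h u k) - difference_quotients h u (k * d.+1)) v
  <= d%:R * beta * h * r.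
Proof.
move=> kN vr; set y := base_point _ _ _ _ _.
have qf := quadratic_remainder (ltW beta0) (objective_differentiable fo)
  (objective_lipschitz fo).
rewrite /dot (le_trans (y := \sum_(i < d) beta * h * r))//; last first.
  by rewrite sumr_const card_ord -[leLHS]mulr_natl; lra.
apply: ler_sum => i _; rewrite !mxE.
have id : (i.+1 < d.+1)%N by rewrite ltnS.
rewrite !uf ?probe_base ?probe_coord -/y; [|nia..].
have := qf y (h *: delta_mx 0 i).
rewrite dotZr dotZl dotZr !dot_delta !mxE !eqxx /= mulr1 => q.
rewrite (le_trans (ler_norm _))// normrM.
have vi : `|v 0 i| <= r.
  rewrite (le_trans _ vr)// -dot_delta (le_trans (Cauchy_Schwarz_norm _ _))//.
  by rewrite ler_piMr ?norm2_ge0// norm2_le_dot// dot_delta mxE !eqxx expr1n.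
apply: ler_pM => //.
rewrite -(ler_pM2l h0) -[X in X * _ <= _](gtr0_norm h0) -normrM -normrN.
have -> : h * (beta * h) = beta * (h * h) by ring.
apply: le_trans q; rewrite le_eqVlt; apply/orP; left; apply/eqP.
congr (`|_|).
by field; rewrite gt_eqF.
Qed.

Lemma finite_difference_potential (w : 'rV[R]_d) k : minimizers f w ->
  norm2 w <= r / 2 -> (k <= N)%N ->
  let: (x, z) := states r beta h u k in
  k%:R * (k%:R + 2) * (f x - f w) + 4 * beta * dot (w - z) (w - z) <=
    4 * beta * dot w w + k%:R * (k%:R + 3) * (d%:R * beta * h * r).
Proof.
move=> wmin wr; elim: k => [_|k IH kN] /=; first by rewrite !mul0r subr0 add0r addr0.
have := IH (ltnW kN); have e (v : 'rV[R]_d) := @difference_quotients_error k v kN.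
have := @norm2_states R d r beta h r0 u k.
move: e; rewrite /base_point; case: (states r beta h u k) => x z e [_ zr] {}IH.
set del := d%:R * beta * h * r in e IH *.
set g := difference_quotients _ _ _ in e *.
set th := momentum k in e *.
have r20 : 0 < r / 2 by rewrite divr_gt0.
have tan p q : f p + dot (gradient f p) (q - p) <= f q.
  exact: convex_above_tangent (ltW beta0) (objective_differentiable fo)
    (objective_lipschitz fo) (objective_convex fo) p q.
have smo p q : f (p + q) <= f p + dot (gradient f p) q + beta * dot q q.
  have := quadratic_remainder (ltW beta0) (objective_differentiable fo)
    (objective_lipschitz fo) p q.
  by rewrite ler_norml => /andP[_]; lra.
have zw : norm2 (proj_ball (r / 2) (z - (2 * beta * th)^-1 *: g) - w) <= r.
  have := norm2_proj_ball (z - (2 * beta * th)^-1 *: g) r20.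
  by have := ler_norm2B (proj_ball (r / 2) (z - (2 * beta * th)^-1 *: g)) w; lra.
have := @accelerated_step _ _ f (gradient f) beta _ beta0 r20 tan smo x z g w th del
  (momentum_itv _) wr (e _ zw).
set z' := proj_ball _ _; set x' := _ *: x + _ => st.
have fx : 0 <= f x - f w by rewrite subr_ge0.
have fx' : 0 <= f x' - f w by rewrite subr_ge0.
have k2 : 0 <= k.+2%:R ^+ 2 :> R by rewrite sqr_ge0.
have {st} := ler_wpM2l k2 st.
rewrite /th /momentum -/del -(natr1 k.+1) -(natr1 k).
set D := dot (w - z) (w - z) in IH *; set D' := dot (w - z') (w - z').
set E := f x - f w in IH fx *; set E' := f x' - f w in fx' *.
move: (ler0n R k) => kR.
have k2n : k%:R + 1 + 1 != 0 :> R by rewrite gt_eqF//; lra.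
have -> : (k%:R + 1 + 1) ^+ 2 * ((1 - 2 / (k%:R + 1 + 1)) * E +
    beta * (2 / (k%:R + 1 + 1)) ^+ 2 * (D - D') + 2 / (k%:R + 1 + 1) * del) =
  k%:R * (k%:R + 2) * E + 4 * beta * (D - D') + 2 * (k%:R + 2) * del.
  by field.
move=> st; lra.
Qed.

Lemma finite_difference_gap : (0 < N)%N ->
  f (states r beta h u N).1 - min_value f <=
    beta * r ^+ 2 / N%:R ^+ 2 + 4 * (d%:R * beta * h * r).
Proof.
move=> N0; have [w wr [wmin _]] := objective_minimizer fo.
rewrite (min_value_attained wmin).
have := finite_difference_potential wmin wr (leqnn N).
case: (states r beta h u N) => x z /=.
have NR : 1 <= N%:R :> R by rewrite ler1n.
have N2 : 0 < N%:R ^+ 2 :> R by rewrite exprn_gt0// ltr0n.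
have del0 : 0 <= d%:R * beta * h * r by rewrite !mulr_ge0// ltW.
set del := d%:R * beta * h * r in del0 *.
have ww : dot w w <= (r / 2) ^+ 2 by rewrite -norm2_le_dot// divr_ge0// ltW.
have := ler_wpM2l (ltW beta0) ww.
have : 0 <= beta * dot (w - z) (w - z) by rewrite mulr_ge0 ?dot_ge0 ?(ltW beta0).
have : 0 <= f x - f w by rewrite subr_ge0.
move: (f x - f w) (N%:R : R) NR N2 => E n NR N2.
move=> E0 h1 h2 h3.
rewrite -lerBlDr ler_pdivlMr//.
have : n ^+ 2 * E <= n * (n + 2) * E by rewrite ler_wpM2r//; lra.
have nn : 0 <= n by lra.
have n1 : 0 <= n - 1 by rewrite subr_ge0.
have : 0 <= (n - 1) * n * del by exact: mulr_ge0 (mulr_ge0 n1 nn) del0.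
lra.
Qed.

End Convergence.

(** * Measurability of the iterates *)

Lemma open_rational_boxes (R : realType) (d : nat) (U : set 'rV[R]_d)
    (x : 'rV[R]_d) : open U -> U x ->
  exists p : 'rV[rat]_d * nat,
    let box := [set y : 'rV[R]_d | forall i,
      y 0 i \in `]ratr (p.1 0 i) - p.2.+1%:R^-1, ratr (p.1 0 i) + p.2.+1%:R^-1[] in
    box x /\ box `<=` U.
Proof.
move=> oU Ux.
have /nbhs_ballP[e /= e0 eU] : nbhs x U by exact: open_nbhs_nbhs.
pose n := Num.truncn (2 / e).
have e2 : 0 < 2 / e by rewrite divr_gt0.
have n1 : n.+1%:R^-1 < e / 2 :> R.
  rewrite -[e / 2]invf_div ltf_pV2 ?posrE//.
  by have /andP[] := truncn_itv (ltW e2).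
have n0 : 0 < n.+1%:R^-1 :> R by rewrite invr_gt0.
have qP (i : 'I_d) : exists q : rat,
    ratr q \in `]x 0 i - n.+1%:R^-1, x 0 i + n.+1%:R^-1[.
  by apply: rat_in_itvoo; move: (n.+1%:R^-1) n0 => D D0; lra.
have {qP} [q0 qP] := choice qP; pose q := \row_(i < d) q0 i.
exists (q, n); split=> [i|y /= yq].
  have := qP i; rewrite !in_itv /= mxE => /andP[].
  by move: (n.+1%:R^-1) => D h1 h2; apply/andP; split; lra.
apply: eU; rewrite mx_norm_ball /ball_ /= [ltLHS]/Num.norm/= mx_normrE.
apply/bigmax_ltP; split=> // -[i j] _ /=; rewrite (ord1 i) !mxE.
have := qP j; have := yq j; rewrite !in_itv /= mxE.
move: (n.+1%:R^-1) n1 => D n1 /andP[h1 h2] /andP[h3 h4].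
by rewrite ltr_norml; apply/andP; split; lra.
Qed.

Lemma measurable_fun_coordinates (disp : measure_display) (T : measurableType disp)
    (R : realType) (d : nat) (F : T -> borelRd R d) :
  (forall i : 'I_d, measurable_fun setT (fun t => (F t : 'rV[R]_d) 0 i)) ->
  measurable_fun setT F.
Proof.
move=> mF; apply: (@measurability _ _ _ _ _ F (@open 'rV[R]_d)) => //.
move=> _ [U oU <-]; rewrite setTI.
pose box (p : 'rV[rat]_d * nat) := [set y : 'rV[R]_d | forall i,
  y 0 i \in `]ratr (p.1 0 i) - p.2.+1%:R^-1, ratr (p.1 0 i) + p.2.+1%:R^-1[].
have -> : F @^-1` U = \bigcup_p (if `[< box p `<=` U >] then F @^-1` (box p) else set0).
  apply/seteqP; split=> [t Ut|t [p _]].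
    have [p [pt pU]] := open_rational_boxes oU Ut.
    by exists p => //; case: asboolP.
  by case: asboolP => // pU /pU.
apply: countable_bigcupT_measurable => [|p]; first exact: countableP.
case: asboolP => // _.
have -> : F @^-1` (box p) = \bigcap_(i in [set: 'I_d])
    (fun t => (F t : 'rV[R]_d) 0 i) @^-1`
      `]ratr (p.1 0 i) - p.2.+1%:R^-1, ratr (p.1 0 i) + p.2.+1%:R^-1[%classic.
  by apply/seteqP; split=> t h i; [move=> _; exact: h | exact: h].
apply: fin_bigcap_measurable => // i _.
by rewrite -[X in measurable X]setTI; apply: mF.
Qed.

Section MeasurableIterates.
Context {disp : measure_display} {T : measurableType disp} {R : realType} {d : nat}.
Variables (r beta h : R) (v : T -> nat -> R).
Hypothesis r0 : 0 < r.
Hypothesis mv : forall i, measurable_fun setT (fun t => v t i).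

Let mcoord (F : T -> 'rV[R]_d) :=
  forall i, measurable_fun setT (fun t => F t 0 i).

Lemma measurable_proj_ball rho F : 0 < rho -> mcoord F ->
  mcoord (fun t => proj_ball rho (F t)).
Proof.
move=> rho0 mF i; pose phi (s : R) := rho / Num.max rho (Num.sqrt s).
have phic : continuous phi.
  move=> s; apply: (@continuousM R R (fun=> rho)
    (fun s => (Num.max rho (Num.sqrt s))^-1)); first exact: cst_continuous.
  apply: (@continuousV R R (fun s => Num.max rho (Num.sqrt s))).
    by rewrite gt_eqF// lt_max rho0.
  apply: (@continuous_max R R (fun=> rho) Num.sqrt).
    exact: cst_continuous.
  exact: sqrt_continuous.
have -> : (fun t => proj_ball rho (F t) 0 i) =
    (fun t => phi (\sum_(j < d) F t 0 j ^+ 2) * F t 0 i).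
  by apply/funext => t; rewrite mxE.
apply: measurable_funM => //.
apply: (measurableT_comp (continuous_measurable_fun phic)).
by apply: measurable_sum => j; exact: measurable_funX.
Qed.

Lemma measurable_states k :
  mcoord (fun t => (states r beta h (v t) k).1) /\
  mcoord (fun t => (states r beta h (v t) k).2).
Proof.
elim: k => [|k [mx mz]] /=.
  by split=> i; under eq_fun do rewrite mxE; exact: measurable_cst.
pose z' t : 'rV[R]_d := proj_ball (r / 2) ((states r beta h (v t) k).2 -
  (2 * beta * momentum k)^-1 *: difference_quotients h (v t) (k * d.+1)).
have mz' : mcoord z'.
  apply: measurable_proj_ball; first by rewrite divr_gt0.
  move=> i; under eq_fun do rewrite !mxE.
  apply: measurable_funB => //; apply: measurable_funM; first exact: measurable_cst.
  by apply: measurable_funM; [exact: measurable_funB | exact: measurable_cst].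
have E t : (let: (x, z) := states r beta h (v t) k in
    ((1 - momentum k) *: x + momentum k *: proj_ball (r / 2)
       (z - (2 * beta * momentum k)^-1 *: difference_quotients h (v t) (k * d.+1)),
     proj_ball (r / 2)
       (z - (2 * beta * momentum k)^-1 *: difference_quotients h (v t) (k * d.+1))))
  = ((1 - momentum k) *: (states r beta h (v t) k).1 + momentum k *: z' t, z' t).
  by rewrite /z'; case: states.
split=> i; under eq_fun do rewrite E /=; last exact: mz'.
rewrite (_ : (fun _ => _) = (fun t => (1 - momentum k) *
    (states r beta h (v t) k).1 0 i + momentum k * z' t 0 i)); last first.
  by apply/funext => t; rewrite !mxE.
apply: measurable_funD.
  by apply: measurable_funM; [exact: measurable_cst | exact: mx].
by apply: measurable_funM; [exact: measurable_cst | exact: mz'].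
Qed.

Lemma measurable_probe t0 : mcoord (fun t => probe r beta h (v t) t0).
Proof.
have [mx mz] := measurable_states (t0 %/ d.+1).
move=> i; have E t : probe r beta h (v t) t0 0 i =
  (1 - momentum (t0 %/ d.+1)) * (states r beta h (v t) (t0 %/ d.+1)).1 0 i +
  momentum (t0 %/ d.+1) * (states r beta h (v t) (t0 %/ d.+1)).2 0 i +
  h *+ (t0 %% d.+1 == i.+1)%N.
  by rewrite /probe /base_point; case: states => x z; rewrite !mxE.
under eq_fun do rewrite E.
apply: measurable_funD; last exact: measurable_cst.
apply: measurable_funD.
  by apply: measurable_funM; [exact: measurable_cst | exact: mx].
by apply: measurable_funM; [exact: measurable_cst | exact: mz].
Qed.

End MeasurableIterates.

Definition values (R : realType) (d t : nat)
    (hist : t.-tuple (observation R d)) : nat -> R :=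
  fun i => nth 0 [seq o.2 | o <- hist] i.

Lemma measurable_values (R : realType) (d t i : nat) :
  measurable_fun setT (fun hist : t.-tuple (observation R d) => values hist i).
Proof.
have [it|ti] := ltnP i t; last first.
  rewrite (_ : (fun _ => _) = cst 0); first exact: measurable_cst.
  by apply/funext => hist; rewrite /values nth_default// size_map size_tuple.
rewrite (_ : (fun _ => _) = snd \o (fun hist => tnth hist (Ordinal it))).
  apply: measurableT_comp; first exact: measurable_snd.
  exact: measurable_tnth.
apply/funext => hist; rewrite /values /=.
by rewrite (nth_map ((0, 0) : observation R d)) ?size_tuple// (tnth_nth (0, 0)).
Qed.

Section FiniteDifferenceAlgorithm.
Context {R : realType} {d : nat} {r beta h : R}.
Hypotheses (r0 : 0 < r) (h0 : 0 < h) (hr : h <= r / 2).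

Definition fd_query (t : nat) (hist : t.-tuple (observation R d)) : borelRd R d :=
  probe r beta h (values hist) t.

Definition fd_output (N : nat) (hist : (N * d.+1).-tuple (observation R d)) :
  borelRd R d := (states r beta h (values hist) N).1.

Lemma fd_query_borel t : borel_map r (@fd_query t).
Proof.
split; last by move=> hist _; exact: norm2_probe.
apply: measurable_funTS; apply: measurable_fun_coordinates.
exact: (measurable_probe beta h r0 (@measurable_values R d t) t).
Qed.

Lemma fd_output_borel N : borel_map r (@fd_output N).
Proof.
split; last first.
  move=> hist _; have [+ _] := @norm2_states R d r beta h r0 (values hist) N.
  by move=> /le_trans; apply; have := ltW r0; lra.
apply: measurable_funTS; apply: measurable_fun_coordinates.
have [mx _] := @measurable_states _ _ R d r beta h (@values R d (N * d.+1)) r0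
  (@measurable_values R d (N * d.+1)) N.
exact: mx.
Qed.

Definition fd_algorithm (N : nat) : algorithm d r (N * d.+1) :=
  Algorithm (fun t _ => fd_query_borel t) (fd_output_borel N).

Lemma values_transcript T (A : algorithm d r T) f t i : (i < t)%N ->
  values (transcript A f t) i = f (query A (transcript A f i)).
Proof.
elim: t => // t IH; rewrite ltnS leq_eqVlt => /predU1P[->|it];
  rewrite /values /= map_rcons nth_rcons size_map size_tuple.
  by rewrite ltnn eqxx.
by rewrite it; exact: IH.
Qed.

Lemma fd_algorithm_gap f N : 0 < beta -> objective r beta f -> (0 < N)%N ->
  f (run (fd_algorithm N) f) - min_value f <=
    beta * r ^+ 2 / N%:R ^+ 2 + 4 * (d%:R * beta * h * r).
Proof.
move=> beta0 fo N0.
apply: (finite_difference_gap r0 beta0 h0 hr fo) => // i iN.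
rewrite values_transcript//; congr f; apply: probe_ext => j ji.
by rewrite !values_transcript// (ltn_trans ji).
Qed.

End FiniteDifferenceAlgorithm.

Lemma complexity_upper_bound (R : realType) (d : nat) (r beta eps : R) :
  0 < r -> 0 < beta -> 0 < eps -> (0 < d)%N -> eps <= beta * r ^+ 2 ->
  (det_ad_complexity d r beta eps
     <= (6 * d%:R * Num.sqrt (beta * r ^+ 2 / eps))%:E)%E.
Proof.
move=> r0 beta0 eps0 d0 hi.
have br0 : 0 < beta * r ^+ 2 by rewrite mulr_gt0// exprn_gt0.
set q := Num.sqrt _.
have q2 : q ^+ 2 = beta * r ^+ 2 / eps by rewrite sqr_sqrtr// ltW// divr_gt0.
have q0 : 0 < q by rewrite sqrtr_gt0 divr_gt0.
have q1 : 1 <= q.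
  by rewrite -ler_sqr ?nnegrE ?(ltW q0)// q2 expr1n ler_pdivlMr// mul1r.
have dR : 1 <= d%:R :> R by rewrite ler1n.
have d0R : 0 < d%:R :> R by rewrite ltr0n.
pose h := eps / (8 * (d%:R * beta * r)).
have D0 : 0 < d%:R * beta * r by rewrite !mulr_gt0.
have h0 : 0 < h by rewrite divr_gt0// mulr_gt0.
have hr : h <= r / 2.
  rewrite ler_pdivrMr ?mulr_gt0// (le_trans hi)//.
  have : beta * r ^+ 2 <= d%:R * (beta * r ^+ 2) by rewrite ler_peMl// ltW.
  have : 0 <= d%:R * (beta * r ^+ 2) by rewrite mulr_ge0 ?ltW.
  by lra.
pose N := (Num.truncn (2 * q)).+1.
have /andP[Nle Ngt] : (Num.truncn (2 * q))%:R <= 2 * q < N%:R.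
  by apply: truncn_itv; lra.
have Nq : N%:R <= 3 * q by rewrite /N -(natr1 (Num.truncn (2 * q))); lra.
pose A := @fd_algorithm R d r beta h r0 h0 hr N.
apply: (@le_trans _ _ (((N * d.+1)%:R : R)%:E)).
  apply: ereal_inf_lbound; exists (N * d.+1)%N => //; exists A.
  apply/worst_case_gapP => f fo.
  rewrite (le_trans (fd_algorithm_gap r0 h0 hr beta0 fo (ltn0Sn _)))//.
  have -> : 4 * (d%:R * beta * h * r) = eps / 2.
    by rewrite /h; field; rewrite !gt_eqF.
  rewrite [leRHS](splitr eps) lerD2r.
  rewrite ler_pdivrMr ?exprn_gt0 ?ltr0n//.
  have : (2 * q) ^+ 2 <= N%:R ^+ 2.
    by rewrite lerXn2r ?nnegrE ?(ltW Ngt)// mulr_ge0// ltW.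
  rewrite exprMn q2 => /(ler_wpM2l (ltW eps0)).
  have -> : eps * (2 ^+ 2 * (beta * r ^+ 2 / eps)) = 4 * (beta * r ^+ 2).
    by field; rewrite gt_eqF.
  by move: (N%:R ^+ 2) => M; lra.
rewrite lee_fin natrM -(natr1 d).
have : d%:R + 1 <= 2 * d%:R :> R by lra.
move=> /(ler_pM (ler0n R N) (addr_ge0 (ltW d0R) ler01) Nq) /le_trans; apply.
lra.
Qed.

Theorem corollary3p6 (R : realType) :
  exists (c C ceps : R) (d0 : nat),
    [/\ 0 < c, 0 < C, 0 < ceps & (0 < d0)%N] /\
    forall (d : nat) (r beta eps : R),
      0 < r -> 0 < beta -> 0 < eps ->
      (d0 <= d)%N ->
      beta * r ^+ 2 * (ln (expR 1 * d%:R) / d%:R) `^ (2 / 3) <= eps ->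
      eps <= ceps * (beta * r ^+ 2) ->
      ((c * d%:R * Num.sqrt (beta * r ^+ 2 / eps))%:E
         <= det_ad_complexity d r beta eps)%E /\
      (det_ad_complexity d r beta eps
         <= (C * d%:R * Num.sqrt (beta * r ^+ 2 / eps))%:E)%E.
Proof.
exists 1024^-1, 6, 4096^-1, 8%N; split; first by rewrite !invr_gt0 !ltr0n.
move=> d r beta eps r0 beta0 eps0 d8 lo hi; split.
  exact: complexity_lower_bound.
apply: complexity_upper_bound => //; first exact: leq_trans d8.
have c1 : 4096^-1 <= 1 :> R by rewrite invf_le1 ?ltr0n ?ler1n.
have br0 : 0 <= beta * r ^+ 2 by rewrite mulr_ge0 ?sqr_ge0 ?ltW.
exact: le_trans hi (ler_piMl br0 c1).
Qed.
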